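(* The group $$(F_4^C)_{E_1,E_2,E_3,F_1(e_k),k=0,1}=\{\alpha\in F_4^C\mid\alpha E_i=E_i\ (i=1,2,3),\ \alpha F_1(e_k)=F_1(e_k)\ (k=0,1)\}$$ is isomorphic to $\mathrm{Spin}(6,C)$.
   Context: $\mathfrak C$ is the real division algebra of octonions with standard basis $e_0=1,e_1,\dots,e_7$, conjugation $x\mapsto\overline x$; $C=\mathbf R\oplus i\mathbf R$ is the field of complex numbers, and $\mathfrak C^C=\mathfrak C\otimes_{\mathbf R}C$ with $C$-linearly extended product and conjugation. $\mathfrak J^C$ is the space of $3\times3$ matrices $$X=\begin{pmatrix}\xi_1&x_3&\overline x_2\\ \overline x_3&\xi_2&x_1\\ x_2&\overline x_1&\xi_3\end{pmatrix},\quad \xi_k\in C,\ x_k\in\mathfrak C^C,$$ with Jordan product $X\circ Y=\frac12(XY+YX)$. $E_k$ is the element with $\xi_k=1$ and all other entries $0$; $F_k(x)$ is the element with $x_k=x$ and all other entries $0$. $F_4^C$ is the group of $C$-linear bijections $\alpha$ of $\mathfrak J^C$ with $\alpha(X\circ Y)=\alpha X\circ\alpha Y$. $\mathrm{Spin}(6,C)$ is the complex spinor group, the universal (double) covering group of $SO(6,C)$. *)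

(* Defs.v *)
From mathcomp Require Import all_boot all_order all_algebra.
From mathcomp Require Import boolp classical_sets functions reals topology.
From mathcomp Require Import normedtype complex ring.

Set Implicit Arguments.
Unset Strict Implicit.
Unset Printing Implicit Defensive.

Import Order.TTheory GRing.Theory Num.Theory.
Import numFieldNormedType.Exports.

Local Open Scope classical_set_scope.
Local Open Scope ring_scope.

(** * Octonions with coefficients in [K]

    [octonion R] is the division algebra of octonions when [R] is the field of
    real numbers; [octonion K], for [K] the complex numbers, is its
    complexification, whose product is the [K]-bilinear extension of the same
    multiplication table. *)

Notation octonion K := 'rV[K]_8.

Definition oct_e (K : nzRingType) (k : 'I_8) : octonion K := delta_mx 0 k.

(* [(i, j, k)] in this list means e_i e_j = e_k, e_j e_k = e_i, e_k e_i = e_j;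
   equivalently e_5 = e_1 e_4, e_6 = e_4 e_2, e_7 = e_3 e_4 in the
   Cayley-Dickson double of the quaternions <e_0, e_1, e_2, e_3>. *)
Definition oct_lines : seq (nat * nat * nat) :=
  [:: (1, 2, 3); (1, 4, 5); (1, 6, 7); (2, 5, 7); (2, 6, 4); (3, 4, 7);
      (3, 5, 6)]%N.

Definition oct_cyclic (i j k : nat) : bool :=
  [|| (i, j, k) \in oct_lines, (j, k, i) \in oct_lines
    | (k, i, j) \in oct_lines].

(* Coefficient of e_k in the product e_i e_j. *)
Definition oct_coef (i j k : nat) : int :=
  if i == 0%N then (j == k)%:R
  else if j == 0%N then (i == k)%:R
  else if i == j then - (k == 0%N)%:R
  else (oct_cyclic i j k)%:R - (oct_cyclic j i k)%:R.

Definition oct_mul (K : nzRingType) (x y : octonion K) : octonion K :=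
  \row_k \sum_i \sum_j x 0 i * y 0 j * (oct_coef i j k)%:~R.

Definition oct_conj (K : nzRingType) (x : octonion K) : octonion K :=
  \row_k (if k == 0 then x 0 k else - x 0 k).

(** * The exceptional Jordan algebra

    [(xi, x)] in [albert K] stands for the Hermitian matrix [albert_mx (xi, x)],
    where [xi] lists xi_1, xi_2, xi_3 and the rows of [x] are x_1, x_2, x_3. *)

Notation albert K := ('rV[K]_3 * 'M[K]_(3, 8))%type.

Definition albert_mx (K : nzRingType) (X : albert K) : 'M[octonion K]_3 :=
  let d k : octonion K := X.1 0 k *: oct_e K 0 in
  let x k : octonion K := row k X.2 in
  let x' k : octonion K := oct_conj (x k) in
  let '(i1, i2, i3) := (0, 1, 2%:R) : 'I_3 * 'I_3 * 'I_3 in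
  \matrix_(i, j)
    nth 0 (nth [::] [:: [:: d i1;  x i3;  x' i2];
                        [:: x' i3; d i2;  x i1 ];
                        [:: x i2;  x' i1; d i3 ]] i) j.

(* Reads the coordinates of a Hermitian matrix; left inverse of [albert_mx]. *)
Definition albert_of_mx (K : nzRingType) (M : 'M[octonion K]_3) : albert K :=
  (\row_k M k k 0 0, \matrix_(k < 3) M (k + 1) (k + 2%:R)).

Definition octmx_mul (K : nzRingType) (M N : 'M[octonion K]_3) :
    'M[octonion K]_3 :=
  \matrix_(i, j) \sum_k oct_mul (M i k) (N k j).

Definition octmx_jordan (K : fieldType) (M N : 'M[octonion K]_3) :
    'M[octonion K]_3 :=
  \matrix_(i, j) (2%:R^-1 *: (octmx_mul M N + octmx_mul N M) i j : octonion K).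

(* See [albert_mx_jordan] for the justification of the use of [albert_of_mx]. *)
Definition jordan (K : fieldType) (X Y : albert K) : albert K :=
  albert_of_mx (octmx_jordan (albert_mx X) (albert_mx Y)).

Definition albert_E (K : nzRingType) (k : 'I_3) : albert K := (delta_mx 0 k, 0).

Definition albert_F (K : nzRingType) (k : 'I_3) (x : octonion K) : albert K :=
  (0, \matrix_(l < 3) (if l == k then x else 0)).

Lemma albert_mxK (K : nzRingType) :
  cancel (@albert_mx K) (@albert_of_mx K).
Proof.
case=> xi x; rewrite /albert_of_mx; congr pair.
  apply/rowP => k; rewrite !mxE.
  by case: k => [[|[|[|]]]] //= p; rewrite !mxE eqxx mulr1; congr (xi _ _);
     apply/val_inj.
apply/matrixP => k l; rewrite !mxE.
by case: k => [[|[|[|]]]] //= p; rewrite !mxE; congr (x _ _); apply/val_inj.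
Qed.

Lemma oct_conjK (K : nzRingType) : involutive (@oct_conj K).
Proof.
by move=> x; apply/rowP => k; rewrite !mxE; case: eqP => // _; rewrite opprK.
Qed.

Lemma oct_conjD (K : nzRingType) : {morph @oct_conj K : x y / x + y}.
Proof.
by move=> x y; apply/rowP => k; rewrite !mxE; case: eqP => // _; rewrite opprD.
Qed.

Lemma oct_conj_mul (K : comNzRingType) (x y : octonion K) :
  oct_conj (oct_mul x y) = oct_mul (oct_conj y) (oct_conj x).
Proof.
pose s (k : nat) : int := if k == 0%N then 1 else - 1.
have cE (z : octonion K) k : oct_conj z 0 k = (s k)%:~R * z 0 k.
  by rewrite !mxE /s -val_eqE /=; case: eqP; rewrite ?mul1r // mulN1r.
have sc (i j k : 'I_8) : s k * oct_coef i j k = s i * s j * oct_coef j i k.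
  have /allP/(_ i) : all (fun i => all (fun j => all (fun k =>
      s k * oct_coef i j k == s i * s j * oct_coef j i k)
      (iota 0 8)) (iota 0 8)) (iota 0 8) by vm_compute.
  rewrite mem_iota ltn_ord => /(_ isT)/allP/(_ j).
  rewrite mem_iota ltn_ord => /(_ isT)/allP/(_ k).
  by rewrite mem_iota ltn_ord => /(_ isT)/eqP.
apply/rowP => k; rewrite cE [in LHS]mxE [in RHS]mxE exchange_big mulr_sumr.
apply: eq_bigr => j _; rewrite mulr_sumr; apply: eq_bigr => i _.
rewrite !cE mulrCA -intrM sc !intrM; move: (_%:~R) (_%:~R) (_%:~R).
move=> a b c; ring.
Qed.

Lemma albert_mx_jordan (K : numFieldType) (X Y : albert K) :
  albert_mx (jordan X Y) = octmx_jordan (albert_mx X) (albert_mx Y).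
Proof.
set A := albert_mx X; set B := albert_mx Y.
have conjZ a (x : octonion K) : oct_conj (a *: x) = a *: oct_conj x.
  by apply/rowP => k; rewrite !mxE; case: eqP => // _; rewrite mulrN.
have conjT (Z : albert K) (i j : 'I_3) :
    albert_mx Z j i = oct_conj (albert_mx Z i j).
  have conj_d a : oct_conj (a *: oct_e K 0) = a *: oct_e K 0.
    rewrite conjZ; congr (_ *: _); apply/rowP => k; rewrite !mxE /=.
    by case: eqP => // _; rewrite oppr0.
  case: i => [[|[|[|]]]] //= pi; case: j => [[|[|[|]]]] //= pj;
    by rewrite !mxE /= ?conj_d ?oct_conjK.
have conjJ (i j : 'I_3) :
    octmx_jordan A B j i = oct_conj (octmx_jordan A B i j).
  have conjS (f : 'I_3 -> octonion K) :
      oct_conj (\sum_k f k) = \sum_k oct_conj (f k).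
    apply: (big_morph _ (@oct_conjD K)).
    by apply/rowP => k; rewrite !mxE; case: ifP; rewrite // oppr0.
  rewrite !mxE conjZ oct_conjD; congr (_ *: _); rewrite addrC !conjS.
  by congr (_ + _); apply: eq_bigr => k _; rewrite oct_conj_mul -!conjT.
rewrite -[LHS]/(albert_mx (albert_of_mx _)); move: (octmx_jordan A B) conjJ.
move=> M hM; have hd i : M i i = M i i 0 0 *: oct_e K 0.
  apply/rowP => k; rewrite !mxE eqxx /=; case: (k =P 0) => [->|/eqP k0].
    by rewrite mulr1.
  rewrite mulr0; have /rowP/(_ k) := hM i i; rewrite mxE (negPf k0).
  by move/eqP; rewrite -addr_eq0 -mulr2n mulrn_eq0 /= => /eqP.
have rowM k : row k (albert_of_mx M).2 = M (k + 1) (k + 2%:R).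
  by apply/rowP => l; rewrite !mxE.
apply/matrixP => i j; rewrite mxE !rowM /=.
case: i => [[|[|[|]]]] //= pi; case: j => [[|[|[|]]]] //= pj;
  rewrite ?[X in X *: _]mxE -?hM -?hd; congr (M _ _); exact/val_inj.
Qed.

(** * Spin groups

    The Clifford algebra of [K ^ n] with v ^ 2 = - (v, v) has the basis e_S,
    [S] ranging over the subsets of the index set, where e_S is the product of
    the e_i for i in [S] in increasing order; an element is the family of its
    coordinates. One has e_S e_T = +- e_(S delta T): sorting the product exchanges
    each i in [S] with the smaller j in [T], and each common index contributes
    the square of a basis vector. *)

Notation clifford K n := ({set 'I_n} -> K).

Definition symdiff (n : nat) (S T : {set 'I_n}) : {set 'I_n} :=
  [set i | (i \in S) (+) (i \in T)]%SET.

Definition cl_sign (K : comNzRingType) (n : nat) (S T : {set 'I_n}) : K :=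
  \prod_(i in S) \prod_(j in T) (-1) ^+ (j <= i)%N.

Definition cl_mul (K : comNzRingType) (n : nat) (x y : clifford K n) :
    clifford K n :=
  fun U => \sum_S cl_sign K S (symdiff S U) * x S * y (symdiff S U).

Definition cl_one (K : comNzRingType) (n : nat) : clifford K n :=
  fun U => (U == finset.set0)%:R.
Arguments cl_one : clear implicits.

Definition cl_vec (K : comNzRingType) (n : nat) (v : 'rV[K]_n) : clifford K n :=
  fun U => \sum_i (U == [set i]%SET)%:R * v 0 i.

(* Products of an even number of unit vectors. Vectors with (v, v) = -1, which
   over the complex numbers are i times unit vectors, are excluded: admitting
   them would give an extension of SO(n) by {1, -1, i, -i}. *)
Definition spin_group (K : comNzRingType) (n : nat) : set (clifford K n) :=
  [set x | exists s : seq 'rV[K]_n,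
    [/\ ~~ odd (size s),
        forall v, v \in s -> \sum_i v 0 i ^+ 2 = 1
      & x = foldr (fun v => cl_mul (cl_vec v)) (cl_one K n) s]].
Arguments spin_group : clear implicits.

Lemma symdiffE n (S T : {set 'I_n}) i :
  (i \in symdiff S T) = (i \in S) (+) (i \in T).
Proof. by rewrite inE. Qed.

Lemma symdiffA n : associative (@symdiff n).
Proof. by move=> S T U; apply/setP => i; rewrite !symdiffE addbA. Qed.

Lemma symdiffK n (S : {set 'I_n}) : involutive (symdiff S).
Proof. by move=> T; apply/setP => i; rewrite !symdiffE addKb. Qed.

Lemma prod_symdiff (K : comNzRingType) n (f : 'I_n -> K) (S T : {set 'I_n}) :
  (forall i, f i * f i = 1) ->
  \prod_(i in symdiff S T) f i = \prod_(i in S) f i * \prod_(i in T) f i.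
Proof.
move=> f2; rewrite big_mkcond [in RHS]big_mkcond [X in _ * X]big_mkcond /=.
rewrite -big_split; apply: eq_bigr => i _ /=; rewrite symdiffE.
by do 2!case: (i \in _); rewrite /= ?mulr1 ?mul1r.
Qed.

Lemma cl_signDr (K : comNzRingType) n (S T U : {set 'I_n}) :
  cl_sign K S (symdiff T U) = cl_sign K S T * cl_sign K S U.
Proof.
rewrite /cl_sign -big_split; apply: eq_bigr => i _; apply: prod_symdiff => j.
by rewrite -expr2 sqrr_sign.
Qed.

Lemma cl_signDl (K : comNzRingType) n (S T U : {set 'I_n}) :
  cl_sign K (symdiff S T) U = cl_sign K S U * cl_sign K T U.
Proof.
apply: prod_symdiff => i; rewrite -big_split big1 // => j _ /=.
by rewrite -expr2 sqrr_sign.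
Qed.

Lemma cl_mulA (K : comNzRingType) n : associative (@cl_mul K n).
Proof.
move=> x y z; apply/funext => U; rewrite /cl_mul.
under [RHS]eq_bigr => S _ do rewrite mulr_sumr mulr_suml.
rewrite [RHS]exchange_big; apply: eq_bigr => P _ /=; rewrite mulr_sumr.
rewrite (reindex_inj (inv_inj (symdiffK P))) /=; apply: eq_bigr => S _.
have -> : symdiff P U = symdiff (symdiff P S) (symdiff S U).
  by apply/setP => i; rewrite !symdiffE; do 3!case: (i \in _).
have -> : symdiff (symdiff P S) (symdiff (symdiff P S) (symdiff S U)) =
          symdiff S U by rewrite symdiffK.
rewrite cl_signDr cl_signDl.
have s2 : cl_sign K P (symdiff S U) * cl_sign K P (symdiff S U) = 1.
  rewrite /cl_sign -big_split big1 // => i _.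
  by rewrite -big_split big1 // => j _; rewrite /= -expr2 sqrr_sign.
transitivity (cl_sign K P (symdiff S U) * cl_sign K P (symdiff S U) *
  (cl_sign K P (symdiff P S) * cl_sign K S (symdiff S U) * x P *
     y (symdiff P S) * z (symdiff S U))); first by ring.
by rewrite s2; ring.
Qed.

Lemma cl_mul1l (K : comNzRingType) n : left_id (cl_one K n) (@cl_mul K n).
Proof.
move=> x; apply/funext => U; rewrite /cl_mul (bigD1 finset.set0) //= big1.
  have -> : symdiff finset.set0 U = U by apply/setP => i; rewrite symdiffE inE.
  by rewrite /cl_one /cl_sign big_set0 eqxx !mul1r addr0.
by move=> S S0; rewrite /cl_one (negPf S0) mulr0 mul0r.
Qed.

Lemma cl_vec_sqr (K : numFieldType) n (v : 'rV[K]_n) :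
  cl_mul (cl_vec v) (cl_vec v) =
  fun U => - (\sum_i v 0 i ^+ 2) * cl_one K n U.
Proof.
apply/funext => U; rewrite /cl_mul.
pose t i j : K := (U == symdiff [set i]%SET [set j]%SET)%:R *
  cl_sign K [set i]%SET [set j]%SET * v 0 i * v 0 j.
transitivity (\sum_i \sum_j t i j).
  rewrite {1}/cl_vec.
  under eq_bigr => S _ do rewrite mulr_sumr mulr_suml.
  rewrite exchange_big; apply: eq_bigr => i _ /=.
  rewrite (bigD1 [set i]%SET) //= big1 ?addr0; last first.
    by move=> S /negPf ->; rewrite mul0r mulr0 mul0r.
  rewrite eqxx mul1r /cl_vec mulr_sumr; apply: eq_bigr => j _; rewrite /t.
  have -> : (U == symdiff [set i]%SET [set j]%SET) =
            (symdiff [set i]%SET U == [set j]%SET).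
    by apply/eqP/eqP => [->|<-]; rewrite symdiffK.
  case: eqP => [->|_]; last by rewrite !(mul0r, mulr0).
  by rewrite !mul1r.
have signE i j : cl_sign K [set i]%SET [set j]%SET = (-1) ^+ (j <= i)%N :> K.
  by rewrite /cl_sign !big_set1.
have tii i : t i i = - v 0 i ^+ 2 * cl_one K n U.
  rewrite /t signE leqnn /cl_one.
  have -> : symdiff [set i]%SET [set i]%SET = finset.set0.
    by apply/setP => k; rewrite symdiffE addbb inE.
  by ring.
have tC i j : i != j -> t i j = - t j i.
  move=> ij; rewrite /t !signE.
  have -> : symdiff [set i]%SET [set j]%SET = symdiff [set j]%SET [set i]%SET.
    by apply/setP => k; rewrite !symdiffE addbC.
  have -> : (j <= i)%N = ~~ (i <= j)%N.
    by rewrite -ltnNge ltn_neqAle val_eqE eq_sym ij.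
  by case: (i <= j)%N => /=; ring.
pose d i j : K := (i == j)%:R * t i i.
have dE : \sum_i \sum_j d i j = - (\sum_i v 0 i ^+ 2) * cl_one K n U.
  rewrite -sumrN mulr_suml; apply: eq_bigr => i _; rewrite (bigD1 i) //= big1.
    by rewrite addr0 /d eqxx mul1r tii.
  by move=> j ji; rewrite /d eq_sym (negPf ji) mul0r.
rewrite -dE; apply/eqP; rewrite -subr_eq0 -sumrB.
under eq_bigr do rewrite -sumrB.
set D := \sum_i _; have : D = - D.
  rewrite {1}/D exchange_big -sumrN; apply: eq_bigr => i _ /=.
  rewrite -sumrN; apply: eq_bigr => j _; rewrite /d.
  have [->|ij] := eqVneq i j; first by rewrite mul1r subrr oppr0.
  by rewrite ?(negPf ij) !mul0r !subr0 tC // eq_sym.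
by move/eqP; rewrite -addr_eq0 -mulr2n mulrn_eq0.
Qed.

Definition F4 (K : numFieldType) : set (albert K -> albert K) :=
  [set f | [/\ linear f, bijective f & {morph f : X Y / jordan X Y}]].
Arguments F4 : clear implicits.

(* The index sets {1, 2, 3} of the E_i and of the F_i are shifted to
   {0, 1, 2}: [albert_F 0] is F_1. *)
Definition F4_fix_E_F1 (K : numFieldType) : set (albert K -> albert K) :=
  [set f | [/\ F4 K f,
      forall i : 'I_3, f (albert_E K i) = albert_E K i
    & forall k : 'I_8, (k <= 1)%N ->
        f (albert_F 0 (oct_e K k)) = albert_F 0 (oct_e K k)]].
Arguments F4_fix_E_F1 : clear implicits.

(** * Isomorphism of topological groups

    [A] and [B] are groups for the operations [mA] and [mB], with the topologies
    induced by [T] and [U]. *)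
Definition topgroup_isom (T U : topologicalType) (mA : T -> T -> T)
    (mB : U -> U -> U) (A : set T) (B : set U) : Prop :=
  exists (f : T -> U) (g : U -> T),
    [/\ forall x, A x -> B (f x) /\ g (f x) = x,
        forall y, B y -> A (g y) /\ f (g y) = y,
        forall x y, A x -> A y -> f (mA x y) = mB (f x) (f y),
        {within A, continuous f}
      & {within B, continuous g}].

(* The complex numbers, with the topology of numeric fields. *)
Definition Cplx (R : realType) : numClosedFieldType := R[i].

(* The topologies on [clifford K n] and on the linear maps are those of finite
   dimensional vector spaces: pointwise convergence of the coordinates, and
   pointwise convergence of maps. *)
Definition clifford_space (K : numClosedFieldType) (n : nat) : topologicalType :=
  {ptws {set 'I_n} -> K}.

Definition albert_maps (K : numClosedFieldType) : topologicalType :=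
  {ptws albert K -> albert K}.

(* Main.v *)
(* An automorphism f fixing E_1, E_2, E_3 preserves the Peirce spaces, hence acts
   on (x_1, x_2, x_3) by a triple of orthogonal maps (a, b, c) such that
   conj (a x * b y) = c (conj (x y)). If moreover f fixes F_1(1), then
   c y = conj (b (conj y)) and b (x y) = a x * b y, that is b L_x b^-1 = L_(a x)
   where L_x is the left multiplication by x; so f is determined by b. The
   L_(e_i), i = 2, ..., 7, generate a representation of the Clifford algebra of
   K ^ 6, which is faithful because the images of the e_S are orthogonal for the
   trace form. As a also fixes e_1, the Cartan-Dieudonne algorithm writes b as a
   sign times a product of L_u for unit vectors u orthogonal to 1 and e_1; the
   number of factors is even because each L_u anticommutes with L_(e_1). The
   isomorphism sends f to the coordinates of b in the images of the e_S; it and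
   its inverse are polynomial, hence continuous. *)
Require Import Defs.
From mathcomp Require Import all_boot all_order all_algebra.
From mathcomp Require Import boolp classical_sets functions reals topology.
From mathcomp Require Import normedtype complex.
From mathcomp Require Import mathcomp_extra ring.

Set Implicit Arguments.
Unset Strict Implicit.
Unset Printing Implicit Defensive.

Import Order.TTheory GRing.Theory Num.Theory.
Import numFieldNormedType.Exports.

Local Open Scope ring_scope.

(** * Left multiplication by octonions *)

(** Transfers a check over [iota 0 8], done by computation, to ['I_8]. *)
Lemma all_ord8 (P : nat -> bool) : all P (iota 0 8) -> forall i : 'I_8, P i.
Proof. by move=> /allP h i; apply: h; rewrite mem_iota ltn_ord. Qed.

(* The right-hand side computes, whereas big operators are locked. *)
Lemma sum_ord8 (F : nat -> int) :
  \sum_(m < 8) F m = foldr (fun m s => F m + s) 0 (iota 0 8).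
Proof. by rewrite -(big_mkord xpredT F) unlock. Qed.

(** Entry (k, l) of L_i L_j^T + L_j L_i^T = 2 (e_i, e_j), where L_i is left multiplication by e_i: a
    polarized form of the multiplicativity of the norm. *)
Lemma oct_coef_polar (i j k l : 'I_8) :
  \sum_(m < 8) (oct_coef i m k * oct_coef j m l +
                oct_coef j m k * oct_coef i m l) =
  2 * (i == j)%:R * (k == l)%:R.
Proof.
rewrite (sum_ord8 (fun m => oct_coef i m k * oct_coef j m l +
  oct_coef j m k * oct_coef i m l)) -!val_eqE; apply/eqP.
have /all_ord8/(_ i)/all_ord8/(_ j)/all_ord8/(_ k)/all_ord8/(_ l) :
  all (fun i =>
  all (fun j => all (fun k => all (fun l =>
  foldr (fun m s => oct_coef i m k * oct_coef j m l +
    oct_coef j m k * oct_coef i m l + s) 0 (iota 0 8) ==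
  2 * (i == j)%:R * (k == l)%:R) (iota 0 8)) (iota 0 8)) (iota 0 8)) (iota 0 8).
  by vm_compute.
exact.
Qed.

Definition oct_sign (k : nat) : int := if k == 0%N then 1 else - 1.

(** The two sides are the real parts of (e_i e_j) e_k and (e_j e_k) e_i, since e_k e_k =
    [oct_sign k]. *)
Lemma oct_coef_cyclic (i j k : 'I_8) :
  oct_coef i j k * oct_sign k = oct_coef j k i * oct_sign i.
Proof.
apply/eqP.
have /all_ord8/(_ i)/all_ord8/(_ j)/all_ord8/(_ k) : all (fun i =>
  all (fun j => all (fun k =>
    oct_coef i j k * oct_sign k == oct_coef j k i * oct_sign i)
  (iota 0 8)) (iota 0 8)) (iota 0 8) by vm_compute.
exact.
Qed.

Lemma oct_coefr0 (i k : 'I_8) : oct_coef i 0 k = (i == k)%:R.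
Proof.
apply/eqP; rewrite -val_eqE.
have /all_ord8/(_ i)/all_ord8/(_ k) : all (fun i =>
  all (fun k => oct_coef i 0 k == (i == k)%:R)
  (iota 0 8)) (iota 0 8) by vm_compute.
exact.
Qed.

(* Lines of the Fano plane separate points: [e_i (e_j (e_k x)) = - x] when [x]
   is [1] or one of [e_i], [e_j], [e_k], and [= x] for the other [e_l]. *)
Lemma oct_coef_line (b : bool) (l : 'I_8) : b || (l != 0) ->
  exists i j k : 'I_8, [/\ i != 0, j != 0, k != 0 &
    forall p : 'I_8,
      \sum_(m < 8) \sum_(n < 8)
        oct_coef i m l * oct_coef j n m * oct_coef k p n =
      - (-1) ^+ (~~ b) * (l == p)%:R /\
      \sum_(m < 8) \sum_(n < 8)
        oct_coef i m p * oct_coef j n m * oct_coef k 0 n = - (p == 0)%:R].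
Proof.
(* The lines that qualify pass through l when [b] is true (any line if l = 0) and avoid l when [b]
   is false. *)
have /all_ord8/(_ l) : all (fun l : nat => all (fun b : bool =>
    b || (l != 0)%N ==>
    has (fun L => let: (i, j, k) := L in
      [&& (0 < i < 8)%N, (0 < j < 8)%N, (0 < k < 8)%N & all (fun p =>
        (foldr (fun m s => foldr (fun n s =>
           oct_coef i m l * oct_coef j n m * oct_coef k p n + s) 0 (iota 0 8)
           + s) 0 (iota 0 8) == - (-1) ^+ (~~ b) * (l == p)%:R) &&
        (foldr (fun m s => foldr (fun n s =>
           oct_coef i m p * oct_coef j n m * oct_coef k 0 n + s) 0 (iota 0 8)
           + s) 0 (iota 0 8) == - (p == 0%N)%:R))
        (iota 0 8)]) oct_lines) [:: true; false]) (iota 0 8) by vm_compute.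
move=> /allP/(_ b); rewrite !inE => + bl; rewrite bl => /(_ (ltac:(by case b))).
case/hasP => -[[i j] k] _ /and4P[/andP[i0 i8] /andP[j0 j8] /andP[k0 k8] tab].
exists (Ordinal i8), (Ordinal j8), (Ordinal k8); split; rewrite -?lt0n //.
move=> p; have /andP[/eqP t1 /eqP t2] := all_ord8 tab p.
rewrite -!val_eqE -t1 -t2; split.
  under eq_bigr => m _ do rewrite (sum_ord8 (fun n =>
    oct_coef i m l * oct_coef j n m * oct_coef k p n)).
  exact: (sum_ord8 (fun m => foldr (fun n s =>
    oct_coef i m l * oct_coef j n m * oct_coef k p n + s) 0 (iota 0 8))).
under eq_bigr => m _ do rewrite (sum_ord8 (fun n =>
  oct_coef i m p * oct_coef j n m * oct_coef k 0 n)).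
exact: (sum_ord8 (fun m => foldr (fun n s =>
  oct_coef i m p * oct_coef j n m * oct_coef k 0 n + s) 0 (iota 0 8))).
Qed.

Section Octonions.

Variable K : numFieldType.
Implicit Types (x y z : octonion K) (u v : 'rV[K]_6).

Definition dot n (x y : 'rV[K]_n) : K := \sum_i x 0 i * y 0 i.

Lemma dotC n (x y : 'rV[K]_n) : dot x y = dot y x.
Proof. by apply: eq_bigr => i _; rewrite mulrC. Qed.

Lemma dotDl n (x y z : 'rV[K]_n) : dot (x + y) z = dot x z + dot y z.
Proof. by rewrite -big_split; apply: eq_bigr => i _; rewrite mxE mulrDl. Qed.

Lemma dotZl n a (x y : 'rV[K]_n) : dot (a *: x) y = a * dot x y.
Proof. by rewrite mulr_sumr; apply: eq_bigr => i _; rewrite mxE mulrA. Qed.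

Lemma dotDr n (x y z : 'rV[K]_n) : dot x (y + z) = dot x y + dot x z.
Proof. by rewrite dotC dotDl !(dotC x). Qed.

Lemma dotZr n a (x y : 'rV[K]_n) : dot x (a *: y) = a * dot x y.
Proof. by rewrite dotC dotZl dotC. Qed.

Lemma dotNl n (x y : 'rV[K]_n) : dot (- x) y = - dot x y.
Proof. by rewrite -scaleN1r dotZl mulN1r. Qed.

Lemma dotNr n (x y : 'rV[K]_n) : dot x (- y) = - dot x y.
Proof. by rewrite dotC dotNl dotC. Qed.

Lemma dot0l n (x : 'rV[K]_n) : dot 0 x = 0.
Proof. by have := dotZl 0 0 x; rewrite scale0r mul0r. Qed.

Lemma dot_delta n (x : 'rV[K]_n) i : dot x (delta_mx 0 i) = x 0 i.
Proof.
rewrite /dot (bigD1 i) //= big1 => [|j ji].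
  by rewrite mxE !eqxx mulr1 addr0.
by rewrite mxE (negPf ji) andbF mulr0.
Qed.

(* Left multiplication by [x], acting on column vectors. *)
Definition lm x : 'M[K]_8 :=
  \matrix_(k, j) \sum_i x 0 i * (oct_coef i j k)%:~R.

Lemma oct_mulE x y : oct_mul x y = y *m (lm x)^T.
Proof.
apply/rowP => k; rewrite !mxE exchange_big; apply: eq_bigr => j _ /=.
rewrite !mxE mulr_sumr; apply: eq_bigr => i _.
by rewrite mulrA (mulrC (x 0 i)).
Qed.

Lemma lmD x y : lm (x + y) = lm x + lm y.
Proof.
apply/matrixP => k j; rewrite !mxE -big_split; apply: eq_bigr => i _.
by rewrite mxE mulrDl.
Qed.

Lemma lmZ a x : lm (a *: x) = a *: lm x.
Proof.
apply/matrixP => k j; rewrite !mxE mulr_sumr; apply: eq_bigr => i _.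
by rewrite mxE mulrA.
Qed.

Lemma lmN x : lm (- x) = - lm x.
Proof. by rewrite -scaleN1r lmZ scaleN1r. Qed.

Lemma lmB x y : lm (x - y) = lm x - lm y.
Proof. by rewrite lmD lmN. Qed.

Lemma lm_col0 x k : lm x k 0 = x 0 k.
Proof.
rewrite mxE (bigD1 k) //= big1 => [|i ik].
  by rewrite oct_coefr0 eqxx mulr1 addr0.
by rewrite oct_coefr0 (negPf ik) mulr0.
Qed.

Lemma lm_inj : injective lm.
Proof. by move=> x y xy; apply/rowP => k; rewrite -!lm_col0 xy. Qed.

(** The Clifford relations, by bilinear extension of [oct_coef_polar]. *)
Lemma lm_polar x y :
  lm x *m (lm y)^T + lm y *m (lm x)^T = (2 * dot x y)%:M.
Proof.
apply/matrixP => k l; rewrite !mxE.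
transitivity (\sum_(i < 8) \sum_(j < 8) x 0 i * y 0 j *
  (2 * (i == j)%:R * (k == l)%:R : int)%:~R).
  rewrite -big_split /=.
  transitivity (\sum_(m < 8) \sum_(i < 8) \sum_(j < 8) x 0 i * y 0 j *
    (oct_coef i m k * oct_coef j m l +
     oct_coef j m k * oct_coef i m l)%:~R); last first.
    rewrite exchange_big; apply: eq_bigr => i _; rewrite exchange_big.
    apply: eq_bigr => j _.
    by rewrite -oct_coef_polar -mulr_sumr rmorph_sum.
  apply: eq_bigr => m _; rewrite !mxE !big_distrlr /=.
  rewrite [X in _ + X]exchange_big -big_split; apply: eq_bigr => i _ /=.
  rewrite -big_split; apply: eq_bigr => j _ /=.
  rewrite intrD !intrM; ring.
rewrite -[RHS]mulr_natr mulr_sumr mulr_suml; apply: eq_bigr => i _.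
rewrite (bigD1 i) //= big1 => [|j ji].
  by rewrite eqxx addr0 !intrM !rmorph_nat mulr1n; ring.
by rewrite eq_sym (negPf ji) mulr0 mul0r mulr0.
Qed.

Lemma lm0 : lm 0 = 0.
Proof. by rewrite -(scale0r 0) lmZ scale0r. Qed.

Lemma lm_e (i k j : 'I_8) : lm (oct_e K i) k j = (oct_coef i j k)%:~R.
Proof.
rewrite mxE (bigD1 i) //= big1 => [|l li];
  first by rewrite mxE !eqxx mul1r addr0.
by rewrite mxE (negPf li) andbF mul0r.
Qed.

Lemma lm_e0 : lm (oct_e K 0) = 1%:M.
Proof.
by apply/matrixP => k j; rewrite lm_e mxE /oct_coef /=
  eq_sym rmorph_nat.
Qed.

Lemma dot_e x i : dot x (oct_e K i) = x 0 i.
Proof. exact: dot_delta. Qed.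

(** [lm_polar] against e_0, whose left multiplication is the identity. The right-hand side is left
    multiplication by the conjugate of x. *)
Lemma lm_tr x : (lm x)^T = (2 * x 0 0)%:M - lm x.
Proof.
have := lm_polar x (oct_e K 0); rewrite lm_e0 trmx1 mulmx1 mul1mx dot_e => <-.
by rewrite addrC addKr.
Qed.

Lemma lm_sqr x : lm x *m (lm x)^T = (dot x x)%:M.
Proof.
have := lm_polar x x; rewrite -mulr2n mulr_natl -scaler_nat.
rewrite raddfMn -[RHS]scaler_nat; apply: scalerI.
by rewrite pnatr_eq0.
Qed.

(** Identifies [K ^ 6] with the span of e_2, ..., e_7, the orthogonal complement of 1 and e_1. *)
Definition imag u : octonion K := row_mx (0 : 'rV_2) u.

Lemma imagE u i : imag u 0 (rshift 2 i) = u 0 i.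
Proof. by rewrite (row_mxEr (0 : 'rV_2)). Qed.

Lemma imag_low u (i : 'I_8) : (i <= 1)%N -> imag u 0 i = 0.
Proof.
move=> i1; rewrite (_ : i = lshift 6 (Ordinal (i1 : (i < 2)%N))).
  by rewrite (row_mxEl (0 : 'rV_2)) mxE.
exact: val_inj.
Qed.

Lemma imag_sub x : x 0 0 = 0 -> x 0 1 = 0 -> exists u, x = imag u.
Proof.
move=> x0 x1; exists (@rsubmx _ 1 2 6 x).
apply/rowP => i; have [j ->|j ->] := split_ordP (i : 'I_(2 + 6)).
  rewrite imag_low /= -1?ltnS //; case: j => [[|[|//]]] p.
    by rewrite -[RHS]x0; congr (x 0 _); apply: val_inj.
  by rewrite -[RHS]x1; congr (x 0 _); apply: val_inj.
by rewrite imagE mxE.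
Qed.

Lemma dot_imag u v : dot (imag u) (imag v) = dot u v.
Proof.
rewrite /dot (@big_split_ord _ _ _ 2 6) /= big1 ?add0r => [|i _].
  by apply: eq_bigr => i _; rewrite !imagE.
by rewrite !imag_low ?mulr0 //= -ltnS.
Qed.

Lemma imagZ a u : imag (a *: u) = a *: imag u.
Proof.
apply/rowP => i; rewrite [RHS]mxE.
have [j ->|j ->] := split_ordP (i : 'I_(2 + 6)).
  by rewrite !imag_low ?mulr0 //= -ltnS.
by rewrite !imagE mxE.
Qed.

Definition gamma (i : 'I_6) : 'M[K]_8 := lm (oct_e K (rshift 2 i)).

Lemma lm_imag u : lm (imag u) = \sum_i u 0 i *: gamma i.
Proof.
have -> : imag u = \sum_i u 0 i *: oct_e K (rshift 2 i).
  apply/rowP => i; rewrite summxE.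
  have [j ->|j ->] := split_ordP (i : 'I_(2 + 6)).
    rewrite imag_low -1?ltnS //= big1 // => l _.
    rewrite !mxE eqxx; case: eqP => [/(congr1 val)/= jl|_];
      last by rewrite mulr0.
    by have := ltn_ord j; rewrite jl.
  rewrite imagE (bigD1 j) //= big1 ?addr0; first by rewrite !mxE !eqxx mulr1.
  move=> l lj; rewrite !mxE eqxx; case: eqP => [jl|_]; last by rewrite mulr0.
  by move: lj; rewrite (@rshift_inj 2 6 _ _ jl) eqxx.
rewrite (big_morph _ lmD lm0); apply: eq_bigr => i _; exact: lmZ.
Qed.

End Octonions.

(** * Triality *)

Section Pin.

Variable K : numFieldType.
Implicit Types (x y z : octonion K) (u v : 'rV[K]_6) (B : 'M[K]_8).

Lemma imag_delta i : imag (delta_mx 0 i : 'rV[K]_6) = oct_e K (rshift 2 i).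
Proof.
apply: lm_inj; rewrite lm_imag (bigD1 i) //= big1 => [|j ji].
  by rewrite mxE !eqxx scale1r addr0.
by rewrite mxE (negPf ji) andbF scale0r.
Qed.

Lemma lm_imag_tr u : (lm (imag u))^T = - lm (imag u).
Proof. by rewrite lm_tr imag_low // mulr0 raddf0 sub0r. Qed.

Lemma lm_e_tr (i : 'I_8) : i != 0 -> (lm (oct_e K i))^T = - lm (oct_e K i).
Proof.
by move=> i0; rewrite lm_tr mxE eq_sym (negPf i0) andbF mulr0 raddf0 sub0r.
Qed.

Lemma lm_sum x : lm x = \sum_i x 0 i *: lm (oct_e K i).
Proof.
rewrite {1}[x]row_sum_delta (big_morph _ (@lmD K) (lm0 K)).
by apply: eq_bigr => i _; rewrite lmZ.
Qed.

(** Conjugation by B when B is orthogonal; the transpose in place of the inverse keeps it polynomial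
    in the entries of B. *)
Definition cj B (M : 'M[K]_8) := B *m M *m B^T.

Lemma cjM B B' M : cj (B *m B') M = cj B (cj B' M).
Proof. by rewrite /cj trmx_mul !mulmxA. Qed.

Lemma cjZ B a M : cj B (a *: M) = a *: cj B M.
Proof. by rewrite /cj -scalemxAr -scalemxAl. Qed.

Lemma cj_mul B M N : B *m B^T = 1%:M -> cj B (M *m N) = cj B M *m cj B N.
Proof.
move=> /mulmx1C BB; rewrite /cj !mulmxA -(mulmxA (B *m M) B^T B) BB mulmx1.
by [].
Qed.

(* [B] stands for the action on x_2 of a product of unit vectors of the span of
   e_2, ..., e_7, and [e] for the parity of the number of factors, which can be
   read off the action on e_1. *)
Definition pin (e : bool) B : Prop :=
  [/\ B *m B^T = 1%:M,
      forall x, exists y, cj B (lm x) = lm y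
    & cj B (lm (oct_e K 1)) = (-1) ^+ e *: lm (oct_e K 1)].

Lemma pin_mul e e' B B' : pin e B -> pin e' B' -> pin (e (+) e') (B *m B').
Proof.
case=> B1 Bl Be [B'1 B'l B'e]; split.
- by rewrite trmx_mul mulmxA -(mulmxA B) B'1 mulmx1.
- by move=> x; have [y xy] := B'l x; rewrite cjM xy.
- by rewrite cjM B'e cjZ Be scalerA signr_addb mulrC.
Qed.

Lemma pin1 : pin false 1%:M.
Proof.
split; rewrite /cj ?trmx1 ?mulmx1 ?mul1mx ?scale1r // => x; exists x.
by rewrite mulmx1 mul1mx.
Qed.

(** On x: 1 is fixed, and the complement of 1 undergoes minus the reflection along u. This follows
    from L_u^2 = -1 by moving L_u past L_x with [lm_polar]. *)
Lemma cj_imag u x : dot u u = 1 -> cj (lm (imag u)) (lm x) =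
  lm ((2 * x 0 0) *: oct_e K 0 + (2 * dot (imag u) x) *: imag u - x).
Proof.
move=> uu; rewrite lmB lmD !lmZ lm_e0 scalemx1 /cj lm_imag_tr.
have LL : lm (imag u) *m lm (imag u) = - 1%:M.
  apply/eqP; rewrite -eqr_oppLR -mulmxN -lm_imag_tr lm_sqr dot_imag uu.
  by rewrite eqxx.
have := lm_polar (imag u) x; rewrite lm_tr lm_imag_tr mulmxBr mul_mx_scalar.
rewrite mulmxN => E.
have -> : lm (imag u) *m lm x = (2 * x 0 0) *: lm (imag u)
    - lm x *m lm (imag u) - (2 * dot (imag u) x)%:M.
  rewrite -E; move: (_ *: _) (lm x *m _) (_ *m lm x) => a c b.
  by rewrite opprD opprK opprB (addrC (b - a)) addrA subrK addrC subrK.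
rewrite mulmxN !mulmxBl -scalemxAl -mulmxA LL mulmxN mulmx1 mul_scalar_mx.
rewrite scalerN scalemx1 !opprB.
by rewrite opprK addrA [LHS]addrC addrA.
Qed.

Lemma pin_imag u : dot u u = 1 -> pin true (lm (imag u)).
Proof.
move=> uu; split; first by rewrite lm_sqr dot_imag uu.
  by move=> x; eexists; exact: cj_imag.
rewrite cj_imag // dot_e imag_low // mxE eqxx /= !mulr0 !scale0r !add0r lmN.
by rewrite expr1 scaleN1r.
Qed.

(** Column i is the image of e_i: if conjugation by B takes L_x to L_y, then y is column 0 of
    L_y. *)
Definition al B : 'M[K]_8 := \matrix_(k, i) cj B (lm (oct_e K i)) k 0.

(* The action of [B] on x_1. *)
Definition ad B x : octonion K := x *m (al B)^T.

Lemma adE B x k : ad B x 0 k = cj B (lm x) k 0.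
Proof.
rewrite lm_sum /cj mulmx_sumr mulmx_suml summxE mxE; apply: eq_bigr => i _.
by rewrite -[in RHS]scalemxAr -[in RHS]scalemxAl !mxE.
Qed.

Lemma ad_lin B a x y : ad B (a *: x + y) = a *: ad B x + ad B y.
Proof. by rewrite /ad mulmxDl scalemxAl. Qed.

Lemma adZ B a x : ad B (a *: x) = a *: ad B x.
Proof. by rewrite /ad scalemxAl. Qed.

Lemma cj_lm e B x : pin e B -> cj B (lm x) = lm (ad B x).
Proof.
case=> _ /(_ x)[y xy] _; rewrite xy; congr lm; apply/rowP => k.
by rewrite adE xy lm_col0.
Qed.

Lemma ad_mul e B B' x : pin e B' -> ad (B *m B') x = ad B (ad B' x).
Proof. by move=> pB'; apply/rowP => k; rewrite !adE cjM (cj_lm _ pB'). Qed.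

Lemma ad_e0 e B : pin e B -> ad B (oct_e K 0) = oct_e K 0.
Proof.
case=> BB _ _; apply/rowP => k; rewrite adE lm_e0 /cj mulmx1 BB -lm_e0.
exact: lm_col0.
Qed.

Lemma ad_e1 e B : pin e B -> ad B (oct_e K 1) = (-1) ^+ e *: oct_e K 1.
Proof. by move=> pB; apply: lm_inj; rewrite -(cj_lm _ pB) lmZ; case: pB. Qed.

Lemma cj_tr B M : (cj B M)^T = cj B M^T.
Proof. by rewrite /cj !trmx_mul trmxK mulmxA. Qed.

(** Conjugation by B fixes scalar matrices, so [lm_polar] has the same right-hand side for the
    images as for x and y. *)
Lemma ad_dot e B x y : pin e B -> dot (ad B x) (ad B y) = dot x y.
Proof.
move=> pB; have [BB _ _] := pB.
have := lm_polar (ad B x) (ad B y); rewrite -!(cj_lm _ pB) !cj_tr.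
rewrite -!(cj_mul _ _ BB) {1 2}/cj -mulmxDl -mulmxDr lm_polar.
rewrite scalar_mxC -mulmxA BB mulmx1 => /matrixP/(_ 0 0); rewrite !mxE eqxx.
by move=> /mulfI -> //; rewrite pnatr_eq0.
Qed.

Lemma ad_imag u x : dot u u = 1 -> ad (lm (imag u)) x =
  (2 * x 0 0) *: oct_e K 0 + (2 * dot (imag u) x) *: imag u - x.
Proof.
by move=> uu; apply: lm_inj; rewrite -(cj_lm _ (pin_imag uu)) cj_imag.
Qed.

Lemma al_orth e B : pin e B -> (al B)^T *m al B = 1%:M.
Proof.
move=> pB; apply/matrixP => i j.
transitivity (dot (ad B (oct_e K i)) (ad B (oct_e K j))).
  rewrite /ad /oct_e -!rowE mxE /dot; apply: eq_bigr => k _.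
  by rewrite !mxE.
by rewrite (ad_dot _ _ pB) dot_e !mxE eq_sym.
Qed.

Lemma ad_trK e B x : pin e B -> ad B (x *m al B) = x.
Proof. by move=> /al_orth/mulmx1C BB; rewrite /ad -mulmxA BB mulmx1. Qed.

Lemma cj_trK B M : B *m B^T = 1%:M -> cj B^T (cj B M) = M.
Proof.
by move=> /mulmx1C BB; rewrite /cj trmxK !mulmxA BB mul1mx -mulmxA BB mulmx1.
Qed.

(** The action on x_1 is orthogonal, so x is the image under [ad B] of [x *m al B], which
    conjugation by the inverse of B gives back. *)
Lemma pin_tr e B : pin e B -> pin e B^T.
Proof.
move=> pB; have [BB Bl Be] := pB; split; first by rewrite trmxK (mulmx1C BB).
  by move=> x; exists (x *m al B); rewrite -{1}(ad_trK x pB) -(cj_lm _ pB)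
    cj_trK.
have e1 := cj_trK (lm (oct_e K 1)) BB; rewrite Be cjZ in e1.
by rewrite -[in RHS]e1 scalerA -expr2 sqrr_sign scale1r.
Qed.

End Pin.

(** * Cartan-Dieudonne decomposition *)

Section Decomposition.

Variable K : numClosedFieldType.
Implicit Types (x y z : octonion K) (u v : 'rV[K]_6) (B : 'M[K]_8).

Definition unit_vectors (s : seq 'rV[K]_6) := forall v, v \in s -> dot v v = 1.

Definition lm_prod (s : seq 'rV[K]_6) : 'M[K]_8 :=
  foldr (fun v M => lm (imag v) *m M) 1%:M s.

Lemma lm_prod_cat s t : lm_prod (s ++ t) = lm_prod s *m lm_prod t.
Proof. by elim: s => [|v s /= ->]; rewrite ?mul1mx // mulmxA. Qed.

Lemma pin_prod s : unit_vectors s -> pin (odd (size s)) (lm_prod s).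
Proof.
elim: s => [_|v s IHs vs] /=; first exact: pin1.
rewrite -addTb; apply: pin_mul; first by apply/pin_imag/vs; rewrite inE eqxx.
by apply: IHs => w ws; apply: vs; rewrite inE ws orbT.
Qed.

(** B commutes or anticommutes, according to [e], with each L_(e_i), i != 0. Products of three of
    these along Fano lines force B 1 to be a multiple of 1, and to vanish if [e] is true. Since B
    e_i = (-1)^e e_i (B 1), B is then a scalar of square 1. *)
Lemma pin_scalar e B : pin e B ->
    (forall i : 'I_8, i != 0 -> ad B (oct_e K i) = (-1) ^+ e *: oct_e K i) ->
  e = false /\ (B = 1%:M \/ B = - 1%:M).
Proof.
move=> pB aB; have [BB _ _] := pB; have BtB := mulmx1C BB.
have Blm (i : 'I_8) : i != 0 ->
    B *m lm (oct_e K i) = (-1) ^+ e *: (lm (oct_e K i) *m B).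
  move=> i0; rewrite scalemxAl -lmZ -aB // -(cj_lm _ pB) /cj -(mulmxA _ B^T)
    BtB.
  by rewrite mulmx1.
pose c k := B k 0.
(* Compare the entries (l, 0) of B M and (-1)^e M B: M sends 1 to -1, and the line is chosen so that
   its entry (l, l) yields - c_l = c_l. *)
have c0 l : e || (l != 0) -> c l = 0.
  move=> el; have [i [j [k [i0 j0 k0 tab]]]] := oct_coef_line el.
  pose M := lm (oct_e K i) *m lm (oct_e K j) *m lm (oct_e K k).
  have ME a b : M a b = (\sum_(m < 8) \sum_(n < 8)
      oct_coef i m a * oct_coef j n m * oct_coef k b n)%:~R.
    rewrite exchange_big rmorph_sum mxE; apply: eq_bigr => n _ /=.
    rewrite mxE mulr_suml; rewrite rmorph_sum; apply: eq_bigr => m _ /=.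
    by rewrite !lm_e !intrM.
  have BM : B *m M = (-1) ^+ e *: (M *m B).
    rewrite /M !mulmxA Blm // -!scalemxAl -(mulmxA _ B) Blm //.
    rewrite -!scalemxAr -!scalemxAl scalerA -!mulmxA Blm // -!scalemxAr scalerA.
    by rewrite -expr2 sqrr_sign mul1r.
  have := congr1 (fun N : 'M[K]_8 => N l 0) BM; rewrite !mxE.
  rewrite (bigD1 0) //= big1 => [|p p0]; last first.
    by rewrite ME (tab p).2 (negPf p0) oppr0 mulr0.
  rewrite (bigD1 l) //= [in RHS]big1 => [|p pl]; last first.
    by rewrite ME (tab p).1 eq_sym (negPf pl) mulr0 mul0r.
  rewrite !ME (tab 0).2 (tab l).1 !eqxx !addr0 -/(c l) mulrN1z mulr1.
  rewrite rmorphN rmorphXn rmorphN1 mulrN mulNr mulrN mulrA -exprD.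
  case: (e) => /=; rewrite ?expr1 ?mulN1r ?opprK => /eqP.
    by rewrite eq_sym -addr_eq0 mulr1 -mulr2n mulrn_eq0 => /eqP.
  by rewrite eq_sym -addr_eq0 mulr1 -mulr2n mulrn_eq0 => /eqP.
(* B e_i is the image of 1 under B L_(e_i), so column 0 determines B. *)
have BE k (i : 'I_8) : B k i = (if i == 0 then 1 else (-1) ^+ e) *
    (lm (oct_e K i) *m B) k 0.
  transitivity ((B *m lm (oct_e K i)) k 0).
    rewrite mxE (bigD1 i) //= big1 => [|j ji]; last first.
      by rewrite lm_col0 mxE (negPf ji) andbF mulr0.
    by rewrite lm_col0 mxE !eqxx mulr1 addr0.
  case: eqVneq => [->|i0]; first by rewrite lm_e0 mulmx1 mul1mx mul1r.
  by rewrite Blm // mxE.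
(* Otherwise column 0 of the orthogonal matrix B would vanish. *)
have e0 : e = false.
  apply: contraTF isT => et; have := congr1 (fun N : 'M[K]_8 => N 0 0) BtB.
  rewrite !mxE eqxx big1 => [/esym/eqP|k _]; first by rewrite oner_eq0.
  by rewrite mxE -/(c k) c0 ?et // mul0r.
split=> //; have {}BE : B = (c 0)%:M.
  apply/matrixP => k i; rewrite BE e0 expr0 if_same mul1r mxE (bigD1 0) //=.
  rewrite big1 => [|j j0]; last by rewrite -/(c j) c0 ?j0 ?orbT // mulr0.
  by rewrite lm_col0 !mxE eqxx addr0 -/(c 0) mulr_natl.
have /eqP : c 0 ^+ 2 = 1.
  have := congr1 (fun N : 'M[K]_8 => N 0 0) BB.
  by rewrite BE tr_scalar_mx -scalar_mxM mxE eqxx mxE eqxx expr2.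
rewrite sqrf_eq1 => /orP[]/eqP cE; [left|right]; rewrite BE cE //.
by rewrite raddfN.
Qed.

(** The sign is the one left open by [pin_scalar]; [stabilizer_lm_prod] removes it. *)
Definition decomposable e B := exists s,
  [/\ unit_vectors s, odd (size s) = e & B = lm_prod s \/ B = - lm_prod s].

(** L_u^2 = -1 gives B = - L_u (L_u B). *)
Lemma decomposable_mul e u B : dot u u = 1 ->
  decomposable (~~ e) (lm (imag u) *m B) -> decomposable e B.
Proof.
move=> uu [s [su so sB]]; exists (u :: s); split=> /=.
- by move=> v; rewrite inE => /orP[/eqP ->|/su].
- by rewrite so negbK.
have -> : B = - (lm (imag u) *m (lm (imag u) *m B)).
  rewrite mulmxA -mulNmx -mulmxN -lm_imag_tr lm_sqr dot_imag uu.
  by rewrite mul1mx.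
by case: sB => ->; rewrite ?mulmxN ?opprK; [right|left].
Qed.

(** L_u negates the vectors orthogonal to 1 and u, which matches the change of parity: basis vectors
    already dealt with stay so. *)
Lemma ad_imag_fix e B u (i : 'I_8) : pin e B -> dot u u = 1 -> i != 0 ->
    imag u 0 i = 0 -> ad B (oct_e K i) = (-1) ^+ e *: oct_e K i ->
  ad (lm (imag u) *m B) (oct_e K i) = (-1) ^+ (~~ e) *: oct_e K i.
Proof.
move=> pB uu i0 ui Bi; rewrite (ad_mul _ _ pB) Bi ad_imag // !mxE eq_sym.
rewrite (negPf i0) dotZr dot_e ui /= !mulr0 !scale0r !add0r -scaleNr.
by rewrite signrN.
Qed.

(* One step of the Cartan-Dieudonne algorithm: the reflection along
   [d = ad B e_k - (-1)^e e_k], when [d] is not isotropic. *)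
Lemma decomposable_step e B (k : 'I_8) : (1 < k)%N -> pin e B ->
    (forall i : 'I_8, (0 < i < k)%N ->
      ad B (oct_e K i) = (-1) ^+ e *: oct_e K i) ->
    let d := ad B (oct_e K k) - (-1) ^+ e *: oct_e K k in
    dot d d != 0 ->
  exists2 u, dot u u = 1 & forall i : 'I_8, (0 < i < k.+1)%N ->
    ad (lm (imag u) *m B) (oct_e K i) = (-1) ^+ (~~ e) *: oct_e K i.
Proof.
move=> k1 pB Bi; set w := ad B _; set t := _ *: _ => d dd.
have k0 : k != 0 by rewrite -lt0n ltnW.
(* For i < k, e_i is a multiple of its own image, and [ad B] preserves its orthogonality to e_k. *)
have wlow (i : 'I_8) : (i < k)%N -> w 0 i = 0.
  move=> ik; rewrite -dot_e.
  have [a ->] : exists a, oct_e K i = a *: ad B (oct_e K i).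
    have [->|i0] := eqVneq i 0; first by exists 1; rewrite (ad_e0 pB) scale1r.
    exists ((-1) ^+ e); rewrite Bi; last by rewrite lt0n i0.
    by rewrite scalerA -expr2 sqrr_sign scale1r.
  by rewrite dotZr (ad_dot _ _ pB) dot_e mxE eqxx -val_eqE ltn_eqF ?andbF
    ?mulr0.
have dlow (i : 'I_8) : (i < k)%N -> d 0 i = 0.
  move=> ik; rewrite /d mxE wlow // add0r !mxE eqxx -val_eqE ltn_eqF // andbF.
  by rewrite mulr0 oppr0.
have [u0 du0] : exists u, d = imag u.
  by apply: imag_sub; apply: dlow => //; apply: ltnW.
pose r := sqrtC (dot d d); have r0 : r != 0 by rewrite sqrtC_eq0.
have r2 : r ^+ 2 = dot d d by exact: sqrtCK.
have uE : imag (r^-1 *: u0) = r^-1 *: d by rewrite imagZ du0.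
have uu : dot (r^-1 *: u0) (r^-1 *: u0) = 1.
  rewrite dotZl dotZr -dot_imag -du0 -r2 mulrA expr2 mulrACA.
  by rewrite mulVf // mulr1.
exists (r^-1 *: u0) => // i /andP[i0];
  rewrite ltnS leq_eqVlt => /orP[/eqP ik|ik].
  have {ik}-> : i = k by exact: val_inj.
  rewrite (ad_mul _ _ pB) -/w ad_imag // wlow ?lt0n // mulr0 scale0r add0r uE.
  rewrite scalerA dotZl.
  (* As w and t have norm 1, (d, d) = 2 (d, w); hence w is sent to d - w = - t. *)
  have -> : 2 * (r^-1 * dot d w) / r = 1.
    have -> : 2 * (r^-1 * dot d w) / r = 2 * dot d w / r ^+ 2.
      by rewrite expr2 invfM; ring.
    have ww : dot w w = 1 by rewrite (ad_dot _ _ pB) dot_e mxE !eqxx.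
    have tt : dot t t = 1.
      by rewrite dotZl dotZr dot_e mxE !eqxx mulr1 -expr2 sqrr_sign.
    have dE : dot d d = 2 * dot d w.
      by rewrite !(dotDl, dotDr, dotNl, dotNr) (dotC t w) ww tt; ring.
    by rewrite -dE r2 divff.
  by rewrite scale1r addrAC subrr sub0r -scaleNr signrN.
apply: ad_imag_fix => //; first by rewrite -lt0n.
  by rewrite uE mxE dlow // mulr0.
by apply: Bi; rewrite i0.
Qed.

(** Induction along the basis: once e_1, ..., e_(n-1) are sent to (-1)^e times themselves, one more
    factor L_u deals with e_n, or two if d is isotropic. At n = 8 [pin_scalar] concludes. *)
Lemma pin_decomposable e B : pin e B -> decomposable e B.
Proof.
have base n (e' : bool) B' : pin e' B' ->
    (forall i : 'I_8, (0 < i < n)%N ->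
      ad B' (oct_e K i) = (-1) ^+ e' *: oct_e K i) ->
    (8 <= n)%N -> decomposable e' B'.
  move=> pB fB n8.
  have [|e0 BE] := pin_scalar pB.
    move=> i i0; apply: fB.
    by rewrite lt0n i0 (leq_trans (ltn_ord i)).
  by exists [::].
(* [m] bounds the number of basis vectors left; the start is n = 2 because [ad_e1] deals with
   e_1. *)
suff main m n : (8 <= n + m)%N -> (1 < n)%N ->
  forall (e' : bool) B', pin e' B' ->
    (forall i : 'I_8, (0 < i < n)%N ->
      ad B' (oct_e K i) = (-1) ^+ e' *: oct_e K i) -> decomposable e' B'.
  move=> pB; apply: (main 6%N 2%N _ _ _ _ pB) => // i /andP[i0 i2].
  have -> : i = 1 by apply/val_inj/eqP; rewrite eqn_leq i0 -ltnS i2.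
  exact: (ad_e1 pB).
elim: m n => [|m IHm] n.
  by rewrite addn0 => n8 _ e' B' pB fB; apply: base pB fB n8.
have [n8 _ n1 e' B' pB fB|n8] := leqP 8 n; first exact: base pB fB n8.
rewrite addnS -addSn => nm n1.
pose k : 'I_8 := Ordinal n8.
pose d e' B' := ad B' (oct_e K k) - (-1) ^+ e' *: oct_e K k.
have step e' B' : pin e' B' -> (forall i : 'I_8, (0 < i < n)%N ->
    ad B' (oct_e K i) = (-1) ^+ e' *: oct_e K i) ->
    dot (d e' B') (d e' B') != 0 -> decomposable e' B'.
  move=> pB fB dd.
  have [u uu fu] := decomposable_step (k := k) n1 pB fB dd.
  apply: (decomposable_mul uu); apply: IHm fu => //; first exact: ltnW.
  by rewrite -addTb; apply: pin_mul (pin_imag uu) pB.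
move=> e' B' pB fB.
have [d0|] := eqVneq (dot (d e' B') (d e' B')) 0; last exact: step.
have [j kj] : exists j : 'I_6, k = rshift 2 j.
  have [j /(congr1 val)/= nj|j kj] := split_ordP (k : 'I_(2 + 6));
    last by exists j.
  by move: n1; rewrite nj ltnNge -ltnS ltn_ord.
(* In the isotropic case, a first factor L_(e_k) makes the new d non-isotropic. *)
pose v : 'rV[K]_6 := delta_mx 0 j.
have vE : imag v = oct_e K k by rewrite imag_delta kj.
have vv : dot v v = 1 by rewrite -dot_imag vE dot_e mxE !eqxx.
apply: (decomposable_mul vv); apply: step.
- by rewrite -addTb; apply: pin_mul (pin_imag vv) pB.
- move=> i /andP[i0 ik]; apply: ad_imag_fix => //.
  + by rewrite -lt0n.
  + by rewrite vE mxE eqxx -val_eqE ltn_eqF ?andbF.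
  + by apply: fB; rewrite i0.
move: d0; rewrite /d (ad_mul _ _ pB) ad_imag // vE.
set w := ad B' _; set ek := oct_e K k; set s := (-1) ^+ e'.
have ss : s * s = 1 by rewrite -expr2 sqrr_sign.
have ww : dot w w = 1 by rewrite (ad_dot _ _ pB) dot_e mxE !eqxx.
have kk : dot ek ek = 1 by rewrite dot_e mxE !eqxx.
have w0 : w 0 0 = 0.
  rewrite -dot_e -(ad_e0 pB) (ad_dot _ _ pB) dot_e mxE eqxx -val_eqE.
  by rewrite ltn_eqF ?andbF // (leq_trans _ n1).
rewrite w0 mulr0 scale0r add0r signrN -/s.
rewrite !(dotDl, dotDr, dotNl, dotNr, dotZl, dotZr) (dotC ek w) ww kk.
set c := dot w ek; rewrite !mulr1 ss.
(* Isotropy of d means (w, s e_k) = 1, so the new d, which is 3 s e_k - w, has (d, d) = 9 - 6 + 1 =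
   4. *)
move=> d0; have sc : s * c = 1.
  have : 2 * (1 - s * c) = 0 by rewrite -d0; ring.
  by move/eqP; rewrite mulf_eq0 pnatr_eq0 /= subr_eq0 => /eqP.
have -> : c = s by rewrite -[c]mul1r -ss -mulrA sc mulr1.
rewrite [X in X != _](_ : _ = 1 + 3 * (s * s)); last by ring.
by rewrite ss mulr1 (_ : 1 + 3 = 4%:R) ?pnatr_eq0 // -(natrD _ 1 3).
Qed.

End Decomposition.

(** * The Clifford representation on octonions *)

Section OrderedProducts.

Variable A : nzRingType.

Lemma mulr_prod_sign n (h : A) (x : nat -> A) (s : nat -> nat) :
    (forall j, (j < n)%N -> h * x j = (-1) ^+ s j * (x j * h)) ->
  h * \prod_(j < n) x j = (-1) ^+ (\sum_(j < n) s j) * (\prod_(j < n) x j * h).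
Proof.
elim: n => [_|n IHn hx]; first by rewrite !big_ord0 expr0 mul1r mulr1 mul1r.
rewrite !big_ord_recr /= mulrA IHn => [|j jn]; last exact/hx/ltnW.
rewrite exprD -!mulrA hx //; congr (_ * _).
by rewrite [LHS]mulrA commr_sign -mulrA.
Qed.

(** The factor g_i changes sign at each g_j with j < i, then meets the factor of index i, where the
    square -1 counts as one more sign; hence the count of the j <= i, as in [cl_sign]. *)
Lemma mulr_prod_insert n (g : nat -> A) (T : nat -> bool) i :
    (forall j, (j < n)%N -> g j * g j = - 1) ->
    (forall j k, (j < n)%N -> (k < n)%N -> j != k ->
      g j * g k = - (g k * g j)) ->
    (i < n)%N ->
  g i * \prod_(j < n) g j ^+ T j =
  (-1) ^+ (\sum_(j < n) (T j && (j <= i)))%N *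
  \prod_(j < n) g j ^+ (T j (+) (j == i :> nat)).
Proof.
elim: n => [//|n IHn] g2 gC; rewrite ltnS leq_eqVlt => /orP[/eqP ->|lt_in].
  rewrite !big_ord_recr /= mulrA.
  rewrite (@mulr_prod_sign _ _ (fun j => g j ^+ T j) (fun j => T j));
    last first.
    move=> j jn; case: (T j); rewrite ?expr0 ?expr1 ?mul1r ?mulr1 //.
    by rewrite gC ?mulN1r // ?gtn_eqF // ltnW.
  rewrite leqnn eqxx andbT addbT exprD -!mulrA; congr (_ * _).
    by congr (_ ^+ _); apply: eq_bigr => j _; rewrite ltnW ?andbT.
  under [in RHS]eq_bigr => j _ do rewrite ltn_eqF // addbF.
  rewrite [RHS]mulrA -commr_sign -mulrA; congr (_ * _).
  by case: (T n); rewrite ?expr0 ?expr1 ?mul1r ?mulr1 ?g2.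
rewrite !big_ord_recr /= mulrA IHn //; last first.
- by move=> j k jn kn; apply: gC; apply: ltnW.
- by move=> j jn; apply: g2; apply: ltnW.
by rewrite leqNgt lt_in andbF addn0 gtn_eqF // addbF mulrA.
Qed.

End OrderedProducts.

Section Representation.

Variable K : numClosedFieldType.
Implicit Types (x y : clifford K 6) (S T : {set 'I_6}) (M : 'M[K]_8).

(* The action on octonions of the basis vector e_S of the Clifford algebra. *)
Definition rep S : 'M[K]_8 := \prod_(i < 6) gamma K i ^+ (i \in S).

Lemma gammaC (i j : 'I_6) : i != j ->
  gamma K i * gamma K j = - (gamma K j * gamma K i).
Proof.
move=> ij; have := lm_polar (oct_e K (rshift 2 i)) (oct_e K (rshift 2 j)).
rewrite dot_e mxE eqxx eq_sym (inj_eq (@rshift_inj 2 6)) (negPf ij) mulr0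
  raddf0.
rewrite !lm_e_tr // !mulmxN => /eqP; rewrite addr_eq0 opprK => /eqP E.
by rewrite -[gamma K j * _]/(gamma K j *m gamma K i) /gamma -E opprK.
Qed.

Lemma gamma_orth i : gamma K i *m (gamma K i)^T = 1%:M.
Proof. by rewrite lm_sqr dot_e mxE !eqxx. Qed.

Lemma gamma_sqr i : gamma K i * gamma K i = - 1.
Proof.
apply/eqP; rewrite -eqr_oppLR -mulrN -lm_e_tr //.
exact/eqP/gamma_orth.
Qed.

Lemma gamma_rep i T : gamma K i *m rep T =
  cl_sign K [set i]%SET T *: rep (symdiff [set i]%SET T).
Proof.
(* [inord] extends the families to all naturals, as [mulr_prod_insert] requires. *)
pose g (j : nat) := gamma K (inord j); pose t (j : nat) := inord j \in T.
have repE S : rep S = \prod_(j < 6) g j ^+ (inord j \in S).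
  by apply: eq_bigr => j _; rewrite /g inord_val.
have -> : gamma K i = g i by rewrite /g inord_val.
rewrite !repE mulmxE (@mulr_prod_insert _ 6 g t) //; last 2 first.
- by move=> j _; apply: gamma_sqr.
- move=> j k j6 k6 jk; apply: gammaC; apply: contraNneq jk => /(congr1 val).
  by rewrite /= !inordK // => ->.
rewrite /cl_sign big_set1 -signr_odd mulr_sign -scaler_sign signr_odd.
congr (_ *: _); last first.
  apply: eq_bigr => j _; rewrite /t !inord_val symdiffE inE addbC.
  by rewrite -(inj_eq val_inj).
rewrite -prodrXr [RHS]big_mkcond; apply: eq_bigr => j _; rewrite /t inord_val.
by case: (j \in T).
Qed.

Lemma rep_orth S : rep S *m (rep S)^T = 1%:M.
Proof.
rewrite /rep; elim/big_ind: _ => [|M N MM NN|i _].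
- by rewrite trmx1 mulmx1.
- by rewrite -mulmxE trmx_mul mulmxA -(mulmxA M) NN mulmx1.
by case: (i \in S); rewrite ?expr0 ?expr1 ?gamma_orth // trmx1 mulmx1.
Qed.

(** [gamma i] anticommutes with every factor of [rep S] except itself. *)
Lemma cj_gamma_rep i S : cj (gamma K i) (rep S) = (-1) ^+ #|S :\ i| *: rep S.
Proof.
pose g (j : nat) := gamma K (inord j); pose t (j : nat) := inord j \in S.
have repE : rep S = \prod_(j < 6) g j ^+ t j.
  by apply: eq_bigr => j _; rewrite /g /t inord_val.
rewrite /cj repE mulmxE.
rewrite (@mulr_prod_sign _ 6 _ (fun j => g j ^+ t j) (fun j =>
  (t j && (inord j != i)))); last first.
  move=> j j6; rewrite /t /g; case: (_ \in S); rewrite ?expr0 ?mulr1 ?mul1r //=.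
  have [->|ji] := eqVneq; first by rewrite mul1r.
  by rewrite mulN1r gammaC // eq_sym.
rewrite -!mulrA -[_ * (gamma K i)^T]/(_ *m _) gamma_orth mulr1.
rewrite -signr_odd mulr_sign -scaler_sign signr_odd; congr (_ ^+ _ *: _).
rewrite -sum1_card [RHS]big_mkcond; apply: eq_bigr => j _.
by rewrite !inE /t inord_val andbC; case: (_ && _).
Qed.

(* If [S] and [T] differ, then some [gamma i] anticommutes with
   [(rep S)^T *m rep T], whose trace therefore vanishes. *)
Lemma tr_rep S T : \tr ((rep S)^T *m rep T) = 8%:R * (S == T)%:R.
Proof.
case: eqVneq => [->|ST]; first by rewrite (mulmx1C (rep_orth T)) mxtrace1 mulr1.
rewrite mulr0.
(* If there is none, the parity of #|S| + #|T| tells for all i at once whether i lies in exactly one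
   of the two sets. Even parity gives S = T; odd parity gives complementary sets, whose cardinals
   add up to 6, which is even. *)
have [i oi] : exists i, odd (#|S :\ i| + #|T :\ i|).
  apply: contra_neqP ST => /forallNP noi.
  have {}noi i : odd (#|S| + #|T|) = (i \in S) (+) (i \in T).
    have := noi i; move/negP/negbTE.
    rewrite (cardsD1 i S) (cardsD1 i T) !oddD !oddb => e.
    by rewrite addbACA e addbF.
  case o : (odd _) noi => noi; last first.
    by apply/setP => i; apply/eqP; rewrite -negb_add -noi.
  have TS : T = ~: S.
    by apply/setP => i; rewrite inE; move: (noi i); do 2!case: (i \in _).
  by move: o; rewrite TS cardsC card_ord.
(* Conjugation preserves the trace, yet here it changes the sign of the matrix. *)
have : \tr (cj (gamma K i) ((rep S)^T *m rep T)) = \tr ((rep S)^T *m rep T).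
  by rewrite /cj mxtrace_mulC mulmxA (mulmx1C (gamma_orth i)) mul1mx.
rewrite cj_mul ?gamma_orth // -cj_tr !cj_gamma_rep.
have -> a (M : 'M[K]_8) : (a *: M)^T = a *: M^T by rewrite linearZ.
rewrite -scalemxAl -scalemxAr scalerA -exprD linearZ /= -signr_odd oi expr1.
rewrite mulN1r => /eqP; rewrite eq_sym -addr_eq0 -mulr2n mulrn_eq0 /=.
by move/eqP.
Qed.

Definition cl_rep x : 'M[K]_8 := \sum_S x S *: rep S.

(** Coordinates along the [rep S], which are orthogonal for the trace form and have square norm
    8. *)
Definition cl_coef M : clifford K 6 := fun S => 8%:R^-1 * \tr ((rep S)^T *m M).

Lemma cl_repK : cancel cl_rep cl_coef.
Proof.
move=> x; apply/funext => S; rewrite /cl_coef /cl_rep mulmx_sumr raddf_sum /=.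
rewrite (bigD1 S) //= big1 => [|T TS].
  rewrite -scalemxAr linearZ /= tr_rep eqxx mulr1 addr0 mulrCA mulVf ?mulr1 //.
  by rewrite pnatr_eq0.
by rewrite -scalemxAr linearZ /= tr_rep eq_sym (negPf TS) !mulr0.
Qed.

(** Multiplicativity for a vector on the left, which [cl_rep_prod] iterates over the factors of a
    spin group element. *)
Lemma cl_rep_vec (v : 'rV[K]_6) y :
  cl_rep (cl_mul (cl_vec v) y) = lm (imag v) *m cl_rep y.
Proof.
rewrite /cl_rep lm_imag mulmx_suml.
transitivity (\sum_U \sum_(i < 6) (v 0 i *
    (cl_sign K [set i]%SET (symdiff [set i]%SET U) * y (symdiff [set i]%SET U)))
    *: rep U).
  apply: eq_bigr => U _; rewrite -scaler_suml; congr (_ *: _).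
  rewrite /cl_mul.
  under eq_bigr => S _ do rewrite /cl_vec mulr_sumr mulr_suml.
  rewrite exchange_big; apply: eq_bigr => i _ /=.
  rewrite (bigD1 [set i]%SET) //= big1 ?addr0 => [|S /negPf ->]; last first.
    by rewrite mul0r mulr0 mul0r.
  by rewrite eqxx mul1r -mulrA mulrCA mulrA.
rewrite exchange_big; apply: eq_bigr => i _ /=.
(* The substitution T = {i} delta U is an involution of the index sets. *)
rewrite mulmx_sumr (reindex_inj (inv_inj (symdiffK [set i]%SET))).
apply: eq_bigr => T _ /=; rewrite symdiffK -scalemxAr -scalemxAl gamma_rep.
rewrite !scalerA; congr (_ *: _); ring.
Qed.

Lemma cl_rep1 : cl_rep (cl_one K 6) = 1%:M.
Proof.
rewrite /cl_rep (bigD1 finset.set0) //= big1 => [|S /negPf S0]; last first.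
  by rewrite /cl_one S0 scale0r.
rewrite /cl_one eqxx scale1r addr0 /rep big1 // => i _.
by rewrite inE expr0.
Qed.

Lemma cl_rep_prod (s : seq 'rV[K]_6) :
  cl_rep (foldr (fun v => cl_mul (cl_vec v)) (cl_one K 6) s) = lm_prod s.
Proof. by elim: s => [|v s IHs] /=; rewrite ?cl_rep1 // cl_rep_vec IHs. Qed.

End Representation.

(** * Stabilizers in the Jordan algebra *)

Section Jordan.

Variable K : numClosedFieldType.
Implicit Types (x y z : octonion K) (X Y : albert K).

Lemma oct_conjZ a x : oct_conj (a *: x) = a *: oct_conj x.
Proof. by apply/rowP => k; rewrite !mxE; case: eqP => // _; rewrite mulrN. Qed.

Lemma oct_conjE x k : oct_conj x 0 k = (oct_sign k)%:~R * x 0 k.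
Proof.
by rewrite mxE /oct_sign -val_eqE /=; case: eqP; rewrite ?mul1r ?mulN1r.
Qed.

Lemma lm_conj x : lm (oct_conj x) = (lm x)^T.
Proof.
rewrite lm_tr -scalemx1 -(lm_e0 K) -lmZ -lmB; congr lm; apply/rowP => k.
rewrite !mxE; case: eqVneq => [->|_]; last by rewrite andbF mulr0 sub0r.
by rewrite mulr1 mulr_natl mulr2n addrK.
Qed.

Lemma oct_mul_e0l a x : oct_mul (a *: oct_e K 0) x = a *: x.
Proof.
by rewrite oct_mulE lmZ lm_e0 scalemx1 tr_scalar_mx mul_mx_scalar.
Qed.

Lemma oct_mul_e0r a x : oct_mul x (a *: oct_e K 0) = a *: x.
Proof.
apply/rowP => k; rewrite oct_mulE -scalemxAl /oct_e -rowE !mxE -[x 0 k]lm_col0.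
by rewrite mxE.
Qed.

Lemma oct_mul_conjr0 x y : oct_mul x (oct_conj y) 0 0 = dot x y.
Proof.
rewrite oct_mulE mxE /dot; apply: eq_bigr => j _.
rewrite mulrC -lm_conj lm_col0 !oct_conjE mulrACA -intrM /oct_sign.
by case: ifP; rewrite ?mulrNN mulr1 mulr1z mul1r mulrC.
Qed.

Lemma oct_mul_conjl0 x y : oct_mul (oct_conj x) y 0 0 = dot x y.
Proof.
rewrite oct_mulE mxE dotC; apply: eq_bigr => j _.
by rewrite lm_conj trmxK lm_col0.
Qed.

(** The two sides are the real parts of (x y) z and (y z) x; by trilinearity [oct_coef_cyclic]
    suffices. *)
Lemma oct_cyclic_dot x y z :
  dot (oct_conj (oct_mul x y)) z = dot (oct_conj (oct_mul y z)) x.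
Proof.
pose t x y z := \sum_(i < 8) \sum_(j < 8) \sum_(k < 8)
  x 0 i * y 0 j * z 0 k * (oct_coef i j k * oct_sign k)%:~R.
have tE a b c : dot (oct_conj (oct_mul a b)) c = t a b c.
  rewrite /t; under [RHS]eq_bigr do rewrite exchange_big.
  rewrite [RHS]exchange_big; apply: eq_bigr => k _ /=.
  rewrite oct_conjE mxE mulr_sumr mulr_suml; apply: eq_bigr => i _.
  rewrite mulr_sumr mulr_suml; apply: eq_bigr => j _.
  by rewrite intrM; ring.
rewrite !tE /t exchange_big; apply: eq_bigr => j _.
rewrite exchange_big; apply: eq_bigr => k _; apply: eq_bigr => i _.
by rewrite oct_coef_cyclic; ring.
Qed.

Lemma sum_ord3 (V : nmodType) (F : 'I_3 -> V) k :
  \sum_i F i = F k + F (k + 1) + F (k + 2%:R).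
Proof.
rewrite (reindex_inj (addrI k)) !big_ord_recl big_ord0 /= !addr0 addrA.
have -> : lift ord0 ord0 = 1 :> 'I_3 by exact: val_inj.
by have -> : lift ord0 (lift ord0 ord0) = 2%:R :> 'I_3 by exact: val_inj.
Qed.

Lemma albert_mx_diag X k : albert_mx X k k = X.1 0 k *: oct_e K 0.
Proof.
by rewrite mxE; case: k => [[|[|[|]]]] //= p; congr (X.1 _ _ *: _);
  apply: val_inj.
Qed.

(** The position is upper in the cyclic sense of ['I_3]: for k = 1 it is (2, 0), where x_2
    stands. *)
Lemma albert_mx_upper X (k i j : 'I_3) : i = k + 1 -> j = k + 2%:R ->
  albert_mx X i j = row k X.2.
Proof.
move=> -> ->; rewrite mxE.
by case: k => [[|[|[|]]]] //= p; congr (row _ _); apply: val_inj.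
Qed.

Lemma albert_mx_lower X (k i j : 'I_3) : i = k + 2%:R -> j = k + 1 ->
  albert_mx X i j = oct_conj (row k X.2).
Proof.
move=> -> ->; rewrite mxE.
by case: k => [[|[|[|]]]] //= p; congr (oct_conj (row _ _)); apply: val_inj.
Qed.

Lemma ord3_add (k : 'I_3) : k + 1 + 2%:R = k /\ k + 2%:R + 1 = k.
Proof. by split; case: k => [[|[|[|]]]] //= p; apply: val_inj. Qed.

Lemma ord3_add2 (k : 'I_3) : k + 1 + 1 = k + 2%:R /\ k + 2%:R + 2%:R = k + 1.
Proof. by split; case: k => [[|[|[|]]]] //= p; apply: val_inj. Qed.

Lemma octmx_mul_diag X Y k :
  octmx_mul (albert_mx X) (albert_mx Y) k k 0 0 = X.1 0 k * Y.1 0 k +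
    dot (row (k + 1) X.2) (row (k + 1) Y.2) +
    dot (row (k + 2%:R) X.2) (row (k + 2%:R) Y.2).
Proof.
have [k12 k21] := ord3_add k; have [k11 k22] := ord3_add2 k.
rewrite mxE (sum_ord3 _ k) !albert_mx_diag oct_mul_e0l -addrA.
rewrite (@albert_mx_upper X (k + 2%:R)) // (@albert_mx_lower Y (k + 2%:R)) //.
rewrite (@albert_mx_lower X (k + 1)) // (@albert_mx_upper Y (k + 1)) //.
rewrite mxE [in X in _ + X = _]mxE oct_mul_conjr0 oct_mul_conjl0 !mxE eqxx
  mulr1.
by rewrite [X in _ + X = _]addrC addrA.
Qed.

Lemma octmx_mul_upper X Y k :
  octmx_mul (albert_mx X) (albert_mx Y) (k + 1) (k + 2%:R) =
    X.1 0 (k + 1) *: row k Y.2 + Y.1 0 (k + 2%:R) *: row k X.2 +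
    oct_conj (oct_mul (row (k + 1) Y.2) (row (k + 2%:R) X.2)).
Proof.
have [k12 k21] := ord3_add k; have [k11 k22] := ord3_add2 k.
rewrite mxE (sum_ord3 _ k) !albert_mx_diag oct_mul_e0l oct_mul_e0r.
rewrite (@albert_mx_lower X (k + 2%:R)) // (@albert_mx_lower Y (k + 1)) //.
rewrite (@albert_mx_upper X k) // (@albert_mx_upper Y k) // -oct_conj_mul.
by rewrite -addrA addrC.
Qed.

Lemma jordan_diag X Y k : (jordan X Y).1 0 k = X.1 0 k * Y.1 0 k +
    dot (row (k + 1) X.2) (row (k + 1) Y.2) +
    dot (row (k + 2%:R) X.2) (row (k + 2%:R) Y.2).
Proof.
have -> : (jordan X Y).1 0 k = 2%:R^-1 *
    (octmx_mul (albert_mx X) (albert_mx Y) k k 0 0 +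
     octmx_mul (albert_mx Y) (albert_mx X) k k 0 0) by rewrite !mxE.
rewrite !octmx_mul_diag !(dotC (row _ Y.2)) (mulrC (Y.1 0 k)).
by rewrite -mulr2n -[X in _ * X]mulr_natl mulrA mulVf ?mul1r // pnatr_eq0.
Qed.

(** The octonion product enters only through conjugates of products of rows k + 1 and k + 2, which
    is what a triality triple respects. *)
Lemma jordan_row X Y k : row k (jordan X Y).2 = 2%:R^-1 *:
   ((X.1 0 (k + 1) + X.1 0 (k + 2%:R)) *: row k Y.2 +
    (Y.1 0 (k + 1) + Y.1 0 (k + 2%:R)) *: row k X.2 +
    oct_conj (oct_mul (row (k + 1) X.2) (row (k + 2%:R) Y.2) +
              oct_mul (row (k + 1) Y.2) (row (k + 2%:R) X.2))).
Proof.
rewrite rowK mxE; congr (_ *: _); rewrite mxE !octmx_mul_upper oct_conjD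
  !scalerDl.
move: (oct_conj _) (oct_conj _) (_ *: _) (_ *: _) (_ *: _) (_ *: _).
by move=> a b c d e f; apply/rowP => i; rewrite !mxE; ring.
Qed.

End Jordan.

(** * Triality triples acting on the Jordan algebra *)

Section Action.

Variable K : numClosedFieldType.
Implicit Types (x y z : octonion K) (X Y : albert K) (B : 'M[K]_8).

Lemma dot_conj x y : dot (oct_conj x) (oct_conj y) = dot x y.
Proof. by rewrite -oct_mul_conjl0 oct_conjK oct_mul_conjr0. Qed.

(* The triality triple of [B]: its actions on x_1, x_2 and x_3. *)
Definition tri B (k : 'I_3) x : octonion K :=
  if k == 0 then ad B x else if k == 1 then x *m B^T
  else oct_conj (oct_conj x *m B^T).

Lemma tri_lin B k a x y : tri B k (a *: x + y) = a *: tri B k x + tri B k y.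
Proof.
rewrite /tri; case: ifP => _; first exact: ad_lin.
by case: ifP => _; rewrite ?oct_conjD ?oct_conjZ mulmxDl -scalemxAl ?oct_conjD
  ?oct_conjZ.
Qed.

Lemma triZ B k a x : tri B k (a *: x) = a *: tri B k x.
Proof.
rewrite /tri; case: ifP => _; first exact: adZ.
by case: ifP => _; rewrite ?oct_conjZ -scalemxAl ?oct_conjZ.
Qed.

Lemma triD B k x y : tri B k (x + y) = tri B k x + tri B k y.
Proof. by rewrite -{1}[x]scale1r tri_lin scale1r. Qed.

Lemma tri_mul e B B' k x : pin e B' -> tri (B *m B') k x = tri B k (tri B' k x).
Proof.
move=> pB'; rewrite /tri; case: ifP => _; first exact: ad_mul pB'.
by case: ifP => _; rewrite trmx_mul mulmxA ?oct_conjK.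
Qed.

Lemma tri1 k x : tri 1%:M k x = x.
Proof.
rewrite /tri trmx1 !mulmx1 oct_conjK; case: ifP => _; last by case: ifP.
by apply/rowP => i; rewrite adE /cj trmx1 mulmx1 mul1mx lm_col0.
Qed.

Lemma tri_trK e B k : pin e B -> cancel (tri B^T k) (tri B k).
Proof.
move=> pB x; have [BB _ _] := pB.
by rewrite -(tri_mul _ _ _ (pin_tr pB)) BB tri1.
Qed.

Lemma tri_dot e B k x y : pin e B -> dot (tri B k x) (tri B k y) = dot x y.
Proof.
move=> pB; have [/mulmx1C BB _ _] := pB.
have dB a b : dot (a *m B^T) (b *m B^T) = dot a b.
  have dE m (u v : 'rV[K]_m) : dot u v = (u *m v^T) 0 0.
    by rewrite mxE; apply: eq_bigr => i _; rewrite !mxE.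
  by rewrite !dE trmx_mul trmxK mulmxA -(mulmxA a) BB mulmx1.
rewrite /tri; case: ifP => _; first exact: ad_dot pB.
by case: ifP => _; rewrite ?dot_conj dB ?dot_conj.
Qed.

Lemma dot_inj x y : (forall z, dot x z = dot y z) -> x = y.
Proof. by move=> xy; apply/rowP => k; rewrite -!dot_e. Qed.

(* For [k = 2] this is the intertwining relation [cj_lm]; the other two cases
   follow because the trilinear form Re (x y z) is cyclic. *)
Lemma tri_conj_mul e B k x y : pin e B ->
  oct_conj (oct_mul (tri B (k + 1) x) (tri B (k + 2%:R) y)) =
  tri B k (oct_conj (oct_mul x y)).
Proof.
move=> pB; have [BB _ _] := pB.
have t2 a b : oct_conj (oct_mul (tri B 0 a) (tri B 1 b)) =
    tri B 2%:R (oct_conj (oct_mul a b)).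
  rewrite /tri /= oct_conjK !oct_mulE -(cj_lm _ pB) cj_tr /cj !mulmxA.
  by rewrite -(mulmxA b) (mulmx1C BB) mulmx1.
pose t k a b c := dot (oct_conj (oct_mul (tri B (k + 1) a)
  (tri B (k + 2%:R) b))) (tri B k c).
(* Rotating the arguments by [oct_cyclic_dot] shifts k by one. *)
have tC a b c k' : t k' a b c = t (k' + 1) b c a.
  by rewrite /t oct_cyclic_dot (ord3_add k').1 (ord3_add2 k').1.
have tk a b c : t k a b c = dot (oct_conj (oct_mul a b)) c.
  have t2E a' b' c' : t 2%:R a' b' c' = dot (oct_conj (oct_mul a' b')) c'.
    have e0 : 2%:R + 1 = 0 :> 'I_3 by exact: val_inj.
    have e1 : 2%:R + 2%:R = 1 :> 'I_3 by exact: val_inj.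
    by rewrite /t e0 e1 t2 (tri_dot _ _ _ pB).
  have [-> |[->| ->]] : k = 2%:R \/ k = 1 \/ k = 0.
    by case: k => [[|[|[|]]]] // p; [right; right|right; left|left];
      apply: val_inj.
  - exact: t2E.
  - rewrite tC (_ : 1 + 1 = 2%:R) // t2E oct_cyclic_dot //.
    by rewrite oct_cyclic_dot.
  - rewrite tC add0r tC (_ : 1 + 1 = 2%:R) // t2E.
    by rewrite oct_cyclic_dot.
(* [tri B k] is onto and preserves [dot], so testing against images is enough. *)
apply: dot_inj => z; rewrite -(tri_trK k pB z) (tri_dot _ _ _ pB).
by rewrite -[RHS]tk.
Qed.

Lemma albert_eq X Y : (forall i, X.1 0 i = Y.1 0 i) ->
  (forall k, row k X.2 = row k Y.2) -> X = Y.
Proof.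
case: X Y => [xi x] [eta y] /= h1 h2; congr pair; first exact/rowP.
exact/row_matrixP.
Qed.

Definition act B X : albert K :=
  (X.1, \matrix_(k < 3) tri B k (row k X.2)).

Lemma act_row B X k : row k (act B X).2 = tri B k (row k X.2).
Proof. exact: rowK. Qed.

Lemma act_mul e B B' X : pin e B' -> act (B *m B') X = act B (act B' X).
Proof.
move=> pB'; congr pair; apply/row_matrixP => k.
by rewrite !rowK (tri_mul _ _ _ pB').
Qed.

Lemma act1 X : act 1%:M X = X.
Proof.
by apply: albert_eq => // k; rewrite rowK tri1.
Qed.

Lemma albert_F_row k x l : row l (albert_F k x).2 = if l == k then x else 0.
Proof. by rewrite rowK. Qed.

Lemma tri0 B k : tri B k 0 = 0.
Proof. by have := triZ B k 0 0; rewrite !scale0r. Qed.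

Lemma act_F B k x : act B (albert_F k x) = albert_F k (tri B k x).
Proof.
congr pair; apply/row_matrixP => l; rewrite !rowK.
by case: eqP => [->|_]; rewrite ?tri0.
Qed.

(** By [jordan_diag] and [jordan_row], the Jordan product is built from [dot] and conjugated
    products, respected by [tri_dot] and [tri_conj_mul]. Even parity makes e_1 fixed rather than
    negated. *)
Lemma act_fix B : pin false B -> F4_fix_E_F1 K (act B).
Proof.
move=> pB; have [BB _ _] := pB; split; [split| |].
- move=> a X Y; congr pair; apply/row_matrixP => k.
  by rewrite rowK !linearP /= tri_lin !rowK.
- exists (act B^T) => X.
    by rewrite -(act_mul _ _ pB) (mulmx1C BB) act1.
  by rewrite -(act_mul _ _ (pin_tr pB)) BB act1.
- move=> X Y; apply: albert_eq => k.
    rewrite [LHS]jordan_diag [RHS]jordan_diag.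
    by rewrite 4!act_row 2!(tri_dot _ _ _ pB).
  rewrite [LHS]act_row [in LHS]jordan_row [RHS]jordan_row.
  rewrite 6![in RHS]act_row.
  by rewrite !oct_conjD triZ !triD !triZ !(tri_conj_mul _ _ _ pB).
- move=> i; congr pair; apply/row_matrixP => k.
  by rewrite rowK linear0 tri0.
move=> k k1; rewrite act_F; congr albert_F; rewrite /tri eqxx.
have [->|k0] := eqVneq k 0; first exact: ad_e0 pB.
have -> : k = 1 by apply/val_inj/eqP; rewrite eqn_leq k1 lt0n k0.
by rewrite (ad_e1 pB) scale1r.
Qed.

(** The map b on x_2, whose index is 1; column j is the image of e_j. *)
Definition spin_mx (f : albert K -> albert K) : 'M[K]_8 :=
  \matrix_(k, j) (f (albert_F 1 (oct_e K j))).2 1 k.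

Lemma spin_mx_act B : spin_mx (act B) = B.
Proof.
apply/matrixP => k j; rewrite mxE act_F mxE eqxx /tri /=.
by rewrite /oct_e -rowE !mxE.
Qed.

End Action.

(** * Recovering the triality triple from an automorphism *)

Section Stabilizer.

Variables (K : numClosedFieldType) (f : albert K -> albert K).
Hypothesis Gf : F4_fix_E_F1 K f.
Implicit Types (x y z : octonion K) (X Y : albert K).

Let f_lin : linear f. Proof. by case: Gf => -[]. Qed.

Let f_jordan : {morph f : X Y / jordan X Y}. Proof. by case: Gf => -[]. Qed.

Let fE i : f (albert_E K i) = albert_E K i. Proof. by case: Gf. Qed.

Let f0 : f 0 = 0.
Proof.
have := f_lin 1 0 0; rewrite !scale1r addr0 => /eqP.
by rewrite -subr_eq subrr eq_sym => /eqP.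
Qed.

Let fZ a X : f (a *: X) = a *: f X.
Proof.
by have := f_lin a X 0; rewrite addr0 f0 addr0.
Qed.

Let fD X Y : f (X + Y) = f X + f Y.
Proof. by have := f_lin 1 X Y; rewrite !scale1r. Qed.

Let f_sum (I : Type) (r : seq I) (F : I -> albert K) :
  f (\sum_(i <- r) F i) = \sum_(i <- r) f (F i).
Proof. exact: (big_morph f fD f0). Qed.

Lemma albert_E_diag (i k : 'I_3) : (albert_E K i).1 0 k = (k == i)%:R.
Proof. by rewrite mxE eqxx. Qed.

Lemma albert_E_row (i k : 'I_3) : row k (albert_E K i).2 = 0.
Proof. exact: linear0. Qed.

Lemma oct_mul0l x : oct_mul 0 x = 0.
Proof. by rewrite oct_mulE lm0 trmx0 mulmx0. Qed.

Lemma oct_mul0r x : oct_mul x 0 = 0.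
Proof. by rewrite oct_mulE mul0mx. Qed.

Lemma oct_conj0 : oct_conj (0 : octonion K) = 0.
Proof. by have := oct_conjZ 0 (0 : octonion K); rewrite !scale0r. Qed.

Lemma jordan_E_diag i X k :
  (jordan (albert_E K i) X).1 0 k = (k == i)%:R * X.1 0 k.
Proof. by rewrite jordan_diag albert_E_diag !albert_E_row !dot0l !addr0. Qed.

Lemma jordan_E_row i X k : row k (jordan (albert_E K i) X).2 =
  (2%:R^-1 * ((k + 1 == i)%:R + (k + 2%:R == i)%:R)) *: row k X.2.
Proof.
rewrite jordan_row !albert_E_diag !albert_E_row scaler0 addr0 oct_mul0l
  oct_mul0r.
by rewrite addr0 oct_conj0 addr0 scalerA.
Qed.

Lemma ord3_neq (k l : 'I_3) : k != l ->
  (k + 1 == l)%:R + (k + 2%:R == l)%:R = 1 :> K.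
Proof.
by case: k l => [[|[|[|]]]] // p [[|[|[|]]]] //= q _; rewrite ?addr0 ?add0r.
Qed.

Lemma albert_F_diag k x i : (albert_F k x).1 0 i = 0.
Proof. by rewrite mxE. Qed.

(** With [jordan_E_F1], these are the Peirce equations of the elements F_k(x); an automorphism
    fixing the E_i preserves them. *)
Lemma jordan_E_F0 k x : jordan (albert_E K k) (albert_F k x) = 0.
Proof.
apply: albert_eq => [i|l].
  by rewrite jordan_E_diag !mxE mulr0.
rewrite jordan_E_row albert_F_row linear0; have [->|_] := eqVneq l k;
  last by rewrite scaler0.
rewrite (_ : _ + _ = 0) ?mulr0 ?scale0r //.
by case: k => [[|[|[|]]]] // p; rewrite addr0.
Qed.

Lemma jordan_E_F1 k x :
  jordan (albert_E K (k + 1)) (albert_F k x) = 2%:R^-1 *: albert_F k x.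
Proof.
apply: albert_eq => [i|l].
  by rewrite jordan_E_diag !mxE !mulr0.
rewrite jordan_E_row linearZ /= albert_F_row; have [->|_] := eqVneq l k;
  last by rewrite !scaler0.
rewrite eqxx (_ : (_ == _) = false) ?addr0 ?mulr1 //.
by case: k => [[|[|[|]]]].
Qed.

Lemma ord3_eq_add (k l : 'I_3) : (k + 1 == l) = (k == l + 2%:R).
Proof. by case: k l => [[|[|[|]]]] // p [[|[|[|]]]]. Qed.

Lemma ord3_eq_add2 (k l : 'I_3) : (k + 2%:R == l) = (k == l + 1).
Proof. by case: k l => [[|[|[|]]]] // p [[|[|[|]]]]. Qed.

Lemma jordan_FF k x y : jordan (albert_F k x) (albert_F k y) =
  dot x y *: (albert_E K (k + 1) + albert_E K (k + 2%:R)).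
Proof.
apply: albert_eq => [i|l].
  rewrite jordan_diag !albert_F_row !albert_F_diag mulr0 add0r !mxE !eqxx /=.
  rewrite ord3_eq_add ord3_eq_add2 addrC mulrDr.
  by congr (_ + _); case: eqP; rewrite ?dot0l ?mulr1 ?mulr0.
rewrite jordan_row !albert_F_row !albert_F_diag !addr0 !scale0r !add0r.
rewrite /= addr0 scaler0 linear0 ord3_eq_add ord3_eq_add2.
have [->|_] := eqVneq l (k + 2%:R).
  rewrite (_ : _ == _ = false) ?oct_mul0r ?addr0 ?oct_conj0 ?scaler0 //.
  by case: k => [[|[|[|]]]].
by rewrite !oct_mul0l addr0 oct_conj0 scaler0.
Qed.

Lemma jordan_F01 x y : jordan (albert_F 0 x) (albert_F 1 y) =
  2%:R^-1 *: albert_F 2%:R (oct_conj (oct_mul x y)).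
Proof.
apply: albert_eq => [i|l].
  rewrite jordan_diag !albert_F_row !albert_F_diag !mxE !mulr0 add0r.
  by case: i => [[|[|[|]]]] //= p; rewrite ?(dotC x) !dot0l addr0.
rewrite jordan_row !albert_F_row !albert_F_diag !addr0 !scale0r !add0r.
rewrite linearZ /= albert_F_row.
by case: l => [[|[|[|]]]] //= p; congr (_ *: _);
  rewrite ?oct_mul0l ?oct_mul0r ?addr0 ?oct_conj0.
Qed.

Lemma albert_sum X :
  X = \sum_i X.1 0 i *: albert_E K i + \sum_k albert_F k (row k X.2).
Proof.
pose p1 i (Z : albert K) := Z.1 0 i; pose p2 k (Z : albert K) := row k Z.2.
have p1D i Y Z : p1 i (Y + Z) = p1 i Y + p1 i Z by rewrite /p1 mxE.
have p2D k Y Z : p2 k (Y + Z) = p2 k Y + p2 k Z by rewrite /p2 linearD.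
have s1 i (F : 'I_3 -> albert K) : p1 i (\sum_j F j) = \sum_j p1 i (F j).
  by apply: (big_morph (p1 i) (p1D i)); rewrite /p1 mxE.
have s2 k (F : 'I_3 -> albert K) : p2 k (\sum_j F j) = \sum_j p2 k (F j).
  by apply: (big_morph (p2 k) (p2D k)); rewrite /p2 linear0.
apply: albert_eq => [i|k].
  rewrite -[RHS]/(p1 i _) p1D !s1 [X in _ + X]big1 => [|j _].
    rewrite (bigD1 i) //= big1 => [|j ji].
      by rewrite /p1 !mxE !eqxx mulr1 !addr0.
    by rewrite /p1 !mxE eq_sym (negPf ji) andbF mulr0.
  by rewrite /p1 mxE.
rewrite -[RHS]/(p2 k _) p2D !s2 big1 => [|j _].
  rewrite add0r (bigD1 k) //= big1 => [|j jk].
    by rewrite /p2 albert_F_row eqxx addr0.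
  by rewrite /p2 albert_F_row eq_sym (negPf jk).
by rewrite /p2 linearZ /= linear0 scaler0.
Qed.

Let phi k x := row k (f (albert_F k x)).2.

(** Multiplication by E_(k+1) has eigenvalues 0 and 1 on the diagonal, never 1/2, so [h1] kills the
    diagonal of the image; multiplication by E_k is 1/2 on the rows other than k, so [h0] kills
    these. *)
Let fF k x : f (albert_F k x) = albert_F k (phi k x).
Proof.
have h0 := congr1 f (jordan_E_F0 k x).
have h1 := congr1 f (jordan_E_F1 k x).
rewrite f0 f_jordan fE in h0; rewrite fZ f_jordan fE in h1.
have half : 2%:R^-1 != 0 :> K by rewrite invr_eq0 pnatr_eq0.
apply: albert_eq => [i|l].
  rewrite (albert_F_diag k (phi k x)).
  have := jordan_E_diag k (f (albert_F k x)) i; rewrite h0 mxE.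
  have := jordan_E_diag (k + 1) (f (albert_F k x)) i; rewrite h1 mxE.
  move: ((f (albert_F k x)).1 0 i) => a.
  have [-> + _|_ + _] := eqVneq i (k + 1); rewrite ?mul1r ?mul0r; last first.
    by move/eqP; rewrite mulf_eq0 (negPf half) => /eqP.
  move=> /eqP; rewrite -[X in _ == X]mul1r eq_sym -subr_eq0 -mulrBl mulf_eq0.
  rewrite (_ : 1 - _ = 2%:R^-1) ?(negPf half) => [/eqP //|].
  by rewrite -[X in X - _](@mulVf _ 2%:R) ?pnatr_eq0 // mulr_natr mulr2n addrK.
rewrite albert_F_row; have [->//|lk] := eqVneq l k.
have := jordan_E_row k (f (albert_F k x)) l; rewrite h0 linear0.
rewrite ord3_neq // mulr1 => /esym/eqP.
by rewrite scaler_eq0 (negPf half) => /eqP.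
Qed.

Let phiZ k a x : phi k (a *: x) = a *: phi k x.
Proof.
rewrite /phi (_ : albert_F k (a *: x) = a *: albert_F k x) ?fZ ?linearZ //.
apply: albert_eq => [i|l]; first by rewrite !mxE mulr0.
by rewrite linearZ /= !albert_F_row; case: eqP => //; rewrite scaler0.
Qed.

Let phiD k x y : phi k (x + y) = phi k x + phi k y.
Proof.
rewrite /phi (_ : albert_F k (x + y) = albert_F k x + albert_F k y) ?fD
  ?linearD //.
apply: albert_eq => [i|l]; first by rewrite !mxE addr0.
by rewrite linearD /= !albert_F_row; case: eqP => //; rewrite addr0.
Qed.

Let phi_dot k x y : dot (phi k x) (phi k y) = dot x y.
Proof.
have := f_jordan (albert_F k x) (albert_F k y); rewrite !fF !jordan_FF.
rewrite fZ fD !fE => /(congr1 (fun X => X.1 0 (k + 1))) /=.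
rewrite !mxE !eqxx (_ : (_ == _) = false) ?addr0 ?mulr1 //.
by case: (k) => [[|[|[|]]]].
Qed.

Let phi_conj_mul x y : oct_conj (oct_mul (phi 0 x) (phi 1 y)) =
  phi 2%:R (oct_conj (oct_mul x y)).
Proof.
have := f_jordan (albert_F 0 x) (albert_F 1 y); rewrite !fF !jordan_F01.
rewrite fZ fF => /scalerI; rewrite invr_eq0 pnatr_eq0 => /(_ isT).
move=> /(congr1 (fun X => row 2%:R X.2)); rewrite /= !albert_F_row !eqxx.
by move->.
Qed.

Let oct_mul_e0 z : oct_mul (oct_e K 0) z = z.
Proof. by rewrite -[oct_e K 0]scale1r oct_mul_e0l scale1r. Qed.

(** [phi_conj_mul] at x = 1, where f fixes F_1(1): the action on x_3 comes from that on x_2. *)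
Let phi_conj y : phi 2%:R (oct_conj y) = oct_conj (phi 1 y).
Proof.
rewrite -{1}[y]oct_mul_e0 -phi_conj_mul {1}/phi; case: Gf => _ _ -> //.
by rewrite albert_F_row oct_mul_e0.
Qed.

Let phi_mul x y : oct_mul (phi 0 x) (phi 1 y) = phi 1 (oct_mul x y).
Proof. by apply: (can_inj (@oct_conjK K)); rewrite phi_conj_mul phi_conj. Qed.

(** [phi_mul] reads B L_x = L_(phi 0 x) B, so B normalizes the left multiplications and determines
    the other two actions. The parity is even because f fixes F_1(e_1). *)
Lemma stabilizer_spin : pin false (spin_mx f) /\ f = act (spin_mx f).
Proof.
set B := spin_mx f.
have phi1 x : phi 1 x = x *m B^T.
  rewrite {1}[x]row_sum_delta (big_morph _ (phiD 1) (_ : phi 1 0 = 0)).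
    apply/rowP => k; rewrite summxE mxE; apply: eq_bigr => j _.
    by rewrite phiZ !mxE.
  by have := phiZ 1 0 0; rewrite !scale0r.
have BB : B *m B^T = 1%:M.
  apply: mulmx1C; apply/matrixP => i j.
  transitivity (dot (phi 1 (oct_e K i)) (phi 1 (oct_e K j))).
    rewrite !phi1 /oct_e -!rowE mxE; apply: eq_bigr => k _.
    by rewrite !mxE.
  by rewrite phi_dot dot_e !mxE eq_sym.
have BtB := mulmx1C BB.
have cjB x : cj B (lm x) = lm (phi 0 x).
  suff h : B *m lm x = lm (phi 0 x) *m B by rewrite /cj h -mulmxA BB mulmx1.
  apply: trmx_inj; apply/row_matrixP => i; rewrite !trmx_mul !rowE.
  have := phi_mul x (delta_mx 0 i); rewrite !phi1 !oct_mulE !mulmxA => <-.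
  by [].
have pB : pin false B.
  split=> // [x|]; first by exists (phi 0 x).
  rewrite cjB scale1r /phi; case: Gf => _ _ -> //.
  by rewrite albert_F_row.
split=> //; have phiE k x : phi k x = tri B k x.
  have [-> |[->| ->]] : k = 2%:R \/ k = 1 \/ k = 0.
    by case: k => [[|[|[|]]]] // p; [right; right|right; left|left];
      apply: val_inj.
  - by rewrite -{1}[x]oct_conjK phi_conj phi1.
  - exact: phi1.
  - by apply: lm_inj; rewrite -cjB (cj_lm _ pB).
apply/funext => X; rewrite {1}(albert_sum X) fD !f_sum [RHS]albert_sum.
congr (_ + _); apply: eq_bigr => i _; first by rewrite fZ fE.
by rewrite fF phiE act_row.
Qed.

End Stabilizer.

(** * Continuity and the isomorphism *)

Section Continuity.

Variable K : numClosedFieldType.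

(** Pointwise convergence is the supremum of the topologies induced by the evaluations. *)
Lemma continuous_into_ptws (T V : topologicalType) (I : Type)
    (h : T -> {ptws I -> V}) :
  (forall i, continuous (fun x => h x i)) -> continuous h.
Proof.
move=> hc x; apply/cvg_sup => i.
move: x; apply/(@continuousP _ (initial_topology (fun f : I -> V => f i))).
move=> _ [B oB <-].
by rewrite -comp_preimage; apply: open_comp => // y _; exact: hc.
Qed.

Variable T : topologicalType.

Lemma continuous_prod (f g : T -> K) : continuous f -> continuous g ->
  continuous (fun x => f x * g x).
Proof. by move=> fc gc x; apply: cvgM; [exact: fc|exact: gc]. Qed.

Lemma continuous_sum (I : Type) (r : seq I) (P : pred I) (F : I -> T -> K) :
  (forall i, continuous (F i)) ->
  continuous (fun x => \sum_(i <- r | P i) F i x).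
Proof. by move=> Fc; apply: continuous_big => //; exact: add_continuous. Qed.

Definition mx_continuous m n (g : T -> 'M[K]_(m, n)) :=
  forall i j, continuous (fun x => g x i j).

Lemma mx_continuousP m n (g : T -> 'M[K]_(m, n)) :
  mx_continuous g -> continuous g.
Proof.
move=> gc x A [P xP sPA]; apply: (filterS (fun t => sPA (g t))).
apply: filter_forall => i; apply: filter_forall => j; exact: (gc i j).
Qed.

Lemma mx_continuous_cst m n (M : 'M[K]_(m, n)) : mx_continuous (fun=> M).
Proof. by move=> i j; exact: cst_continuous. Qed.

Lemma mx_continuous_mul m n p (g : T -> 'M[K]_(m, n)) (h : T -> 'M[K]_(n, p)) :
  mx_continuous g -> mx_continuous h -> mx_continuous (fun x => g x *m h x).
Proof.
move=> gc hc i j; under eq_fun do rewrite mxE.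
by apply: continuous_sum => k; apply: continuous_prod.
Qed.

Lemma mx_continuous_tr m n (g : T -> 'M[K]_(m, n)) :
  mx_continuous g -> mx_continuous (fun x => (g x)^T).
Proof. by move=> gc i j; under eq_fun do rewrite mxE; exact: gc. Qed.

Lemma mx_continuous_conj (g : T -> octonion K) :
  mx_continuous g -> mx_continuous (fun x => oct_conj (g x)).
Proof.
move=> gc i j; rewrite ord1; under eq_fun do rewrite oct_conjE.
by apply: continuous_prod; [exact: cst_continuous|exact: gc].
Qed.

Lemma mx_continuous_tri (g : T -> 'M[K]_8) k x :
  mx_continuous g -> mx_continuous (fun t => tri (g t) k x).
Proof.
move=> gc; rewrite /tri; case: (k == 0).
  move=> i j; rewrite ord1.
  rewrite (_ : (fun t => _) = (fun t => cj (g t) (lm x) j 0)); last first.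
    by apply/funext => t; rewrite adE.
  rewrite /cj; apply: mx_continuous_mul; last exact: mx_continuous_tr.
  by apply: mx_continuous_mul => //; exact: mx_continuous_cst.
case: (k == 1); last apply: mx_continuous_conj;
  by apply: mx_continuous_mul;
    [exact: mx_continuous_cst|exact: mx_continuous_tr].
Qed.

End Continuity.

Section Isomorphism.

Variable K : numClosedFieldType.

(** The coordinates are linear in the values of h at the F_2(e_j), and evaluations are
    continuous. *)
Lemma continuous_cl_coef :
  continuous
    (fun h : albert_maps K => cl_coef (spin_mx h) : clifford_space K 6).
Proof.
apply: continuous_into_ptws => S; rewrite /cl_coef.
apply: continuous_prod; first exact: cst_continuous.
apply: continuous_sum => i; apply: mx_continuous_mul.
  exact: mx_continuous_cst.
move=> {i} a b; under eq_fun do rewrite mxE.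
have c1 : continuous (fun h : albert_maps K => h (albert_F 1 (oct_e K b))).
  exact: (@proj_continuous _ (fun=> albert K) (albert_F 1 (oct_e K b))).
have c2 : continuous (fun X : albert K => X.2 1 a).
  move=> X; apply: (@continuous_comp _ _ _ snd (fun M : 'M[K]_(3, 8) => M 1 a)).
    exact: cvg_snd.
  exact: coord_continuous.
by move=> h; exact: (continuous_comp (c1 h) (c2 _)).
Qed.

Lemma continuous_act :
  continuous (fun x : clifford_space K 6 => act (cl_rep x) : albert_maps K).
Proof.
apply: continuous_into_ptws => X.
have Mc : continuous (fun x : clifford_space K 6 =>
    \matrix_(k < 3) tri (cl_rep x) k (row k X.2) : 'M[K]_(3, 8)).
  apply: mx_continuousP => k j; under eq_fun do rewrite mxE.
  apply: mx_continuous_tri => {k j} a b; rewrite /cl_rep.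
  under eq_fun do rewrite summxE.
  apply: continuous_sum => S; under eq_fun do rewrite mxE.
  apply: continuous_prod; last exact: cst_continuous.
  exact: (@proj_continuous _ (fun=> K : topologicalType) S).
move=> x; exact: (cvg_pair (cvg_cst X.1) (Mc x)).
Qed.

(** A minus sign is absorbed by two more factors equal to v, since L_v L_v = -1. *)
Lemma stabilizer_lm_prod f : F4_fix_E_F1 K f ->
  exists s : seq 'rV[K]_6,
    [/\ ~~ odd (size s), unit_vectors s & spin_mx f = lm_prod s].
Proof.
move=> /stabilizer_spin[/pin_decomposable[s [su so sB]] _].
case: sB => sB; first by exists s; rewrite so.
pose v : 'rV[K]_6 := delta_mx 0 0.
have vv : dot v v = 1 by rewrite dot_delta mxE !eqxx.
exists [:: v, v & s]; split; first by rewrite /= negbK so.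
  by move=> w; rewrite !inE => /orP[/eqP->|/orP[/eqP->|/su]].
rewrite sB /= mulmxA -[X in _ *m X *m _]opprK -lm_imag_tr mulmxN lm_sqr.
by rewrite dot_imag vv mulNmx mul1mx.
Qed.

(** [cl_repK] gives one composite of [cl_rep] and [cl_coef]; the other is the identity on products
    of vectors, hence the recourse to [stabilizer_lm_prod]. *)
Lemma spin_group_isom :
  @topgroup_isom (albert_maps K) (clifford_space K 6)
    (fun f g => (f \o g)%FUN) (fun x y => cl_mul x y)
    (F4_fix_E_F1 K) (spin_group K 6).
Proof.
exists (fun h => cl_coef (spin_mx h)), (fun x => act (cl_rep x)).
have fold_cat s t : foldr (fun v => cl_mul (cl_vec v)) (cl_one K 6) (s ++ t) =
    cl_mul (foldr (fun v => cl_mul (cl_vec v)) (cl_one K 6) s)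
      (foldr (fun v => cl_mul (cl_vec v)) (cl_one K 6) t).
  by elim: s => [|v s IHs] /=; rewrite ?cl_mul1l // IHs cl_mulA.
split.
- move=> f Gf; have [s [so su sf]] := stabilizer_lm_prod Gf.
  rewrite sf -cl_rep_prod cl_repK cl_rep_prod -sf; split; last first.
    by rewrite -(stabilizer_spin Gf).2.
  by exists s.
- move=> _ [s [so su ->]]; rewrite cl_rep_prod spin_mx_act -cl_rep_prod cl_repK.
  split=> //; rewrite cl_rep_prod; apply: act_fix.
  by rewrite -(negbTE so); exact: pin_prod.
- move=> f g Gf Gg; have [s [so su sf]] := stabilizer_lm_prod Gf.
  have [t [to tu tg]] := stabilizer_lm_prod Gg.
  have -> : spin_mx (f \o g)%FUN = lm_prod (s ++ t).
    rewrite -[RHS]spin_mx_act lm_prod_cat -sf -tg; congr spin_mx.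
    apply/funext => X; rewrite (act_mul _ _ (stabilizer_spin Gg).1) /=.
    by rewrite -(stabilizer_spin Gg).2 -(stabilizer_spin Gf).2.
  by rewrite sf tg -!cl_rep_prod !cl_repK fold_cat.
- exact/continuous_subspaceT/continuous_cl_coef.
- exact/continuous_subspaceT/continuous_act.
Qed.

End Isomorphism.

Theorem theorem3p16 (R : realType) :
  @topgroup_isom (albert_maps (Cplx R)) (clifford_space (Cplx R) 6)
    (fun f g => (f \o g)%FUN) (fun x y => cl_mul x y)
    (F4_fix_E_F1 (Cplx R)) (spin_group (Cplx R) 6).
Proof. exact: spin_group_isom. Qed.
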